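(* Let $\kappa>0$ and let $Z$ be a $\kappa$-self-similar Markov process with transition function $P$. Let $\psi$ be the Laplace exponent of a subordinator $\zeta$, and for $u\ge1$ let $G_u$ be the law of $R_u:=\exp(-\zeta_{\ln u})$. Then there exists a Markov process $X=(X_t)_{t\ge0}$ with $X_0=0$ and transition function \[ \widetilde P(0,t,0,\mathrm{d}y)=P(0,t,0,\mathrm{d}y),\qquad \widetilde P(s,t,x,\mathrm{d}y)=\mathbb{E}\bigl[P\bigl(R_{t/s}t,\,t,\,(t/s)^{\kappa}R_{t/s}^{\kappa}x,\,\mathrm{d}y\bigr)\bigr],\quad 0<s\le t, \] which is $\kappa$-self-similar and has the same one-dimensional marginal distributions as $Z$. Furthermore, if $Z$ is a martingale and $\psi(\kappa)=\kappa$ (equivalently $\mathbb{E}[R_{t/s}^\kappa]=(s/t)^\kappa$ for all $0<s\le t$), then $X$ is also a martingale.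
   Context: $Z=(Z_t)_{t\ge0}$ is a real-valued càdlàg Markov process that is $\kappa$-self-similar: $(Z_{ct})_{t\ge0}\stackrel{d}{=}(c^\kappa Z_t)_{t\ge0}$ in finite-dimensional distributions for all $c>0$ (so $Z_0=0$); $P(s,t,x,\mathrm{d}y)=\mathbb{P}(Z_t\in\mathrm{d}y\mid Z_s=x)$. A subordinator is a process with nonnegative, independent and stationary increments started at $0$; its Laplace exponent $\psi$ is defined by $\mathbb{E}[e^{-\lambda\zeta_a}]=\exp(-a\psi(\lambda))$, $\lambda\ge0$, and has the form $\psi(\lambda)=\beta\lambda+\int_0^\infty(1-e^{-\lambda x})\nu(\mathrm{d}x)$ with drift $\beta\ge0$ and Lévy measure $\nu$ ($\nu(\{0\})=0$, $\int(1\wedge x)\nu(\mathrm{d}x)<\infty$). *)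

(* Defs.v *)
From HB Require Import structures.
From mathcomp Require Import all_boot all_order all_algebra.
From mathcomp Require Import all_classical all_reals all_analysis.
From mathcomp Require Import measurable_realfun.
Set Implicit Arguments. Unset Strict Implicit. Unset Printing Implicit Defensive.
Import Order.TTheory GRing.Theory Num.Theory.
Import numFieldNormedType.Exports.
Local Open Scope classical_set_scope.
Local Open Scope ring_scope.

Section Defs.
Context {R : realType}.

(* A transition-function-like object: P s t x A ~ P(Z_t in A | Z_s = x). *)
Definition trfun := R -> R -> R -> set R -> \bar R.

Section Process.
Context {d : measure_display} {T : measurableType d} (Q : probability T R).

Definition process_measurable (Y : R -> T -> R) :=
  forall t, 0 <= t -> measurable_fun setT (Y t).

Definition nat_filtration (Y : R -> T -> R) (s : R) : set (set T) :=
  <<s [set B | exists u (A : set R), [/\ 0 <= u <= s, measurable A & B = Y u @^-1` A]] >>.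

Definition cadlag (Y : R -> T -> R) :=
  forall w, (forall t, 0 <= t -> (Y^~ w) @ t^'+ --> Y t w) /\
            (forall t, 0 < t -> cvg ((Y^~ w) @ t^'-)).

(* Y is a Markov process (w.r.t. its natural filtration) with transition
   function K: for 0 <= s <= t, B in F^Y_s, A Borel,
   P(B /\ Y_t in A) = E[1_B K(s,t,Y_s,A)]  i.e.  P(Y_t in A | F_s) = K(s,t,Y_s,A). *)
Definition markov_with (Y : R -> T -> R) (K : trfun) :=
  forall s t, 0 <= s -> s <= t -> forall (B : set T) (A : set R),
    nat_filtration Y s B -> measurable A ->
    (Q (B `&` Y t @^-1` A) = \int[Q]_(w in B) K s t (Y s w) A)%E.

(* kappa-self-similarity: (Y_{ct})_t =d (c^kappa Y_t)_t in finite-dimensional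
   distributions (the joint laws of finitely many coordinates agree on all
   Borel rectangles, which determine them) *)
Definition self_similar (kappa : R) (Y : R -> T -> R) :=
  forall (c : R), 0 < c -> forall (n : nat) (t : nat -> R) (A : nat -> set R),
    (forall i, 0 <= t i) -> (forall i, measurable (A i)) ->
    Q (\bigcap_(i in [set i | (i < n)%N]) [set w | A i (Y (c * t i) w)]) =
    Q (\bigcap_(i in [set i | (i < n)%N]) [set w | A i (c `^ kappa * Y (t i) w)]).

Definition martingale (Y : R -> T -> R) :=
  (forall t, 0 <= t -> Q.-integrable setT (EFin \o Y t)) /\
  forall s t, 0 <= s -> s <= t -> forall B, nat_filtration Y s B ->
    (\int[Q]_(w in B) (Y t w)%:E = \int[Q]_(w in B) (Y s w)%:E)%E.

Definition subordinator (zeta : R -> T -> R) (psi : R -> R) :=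
  [/\ process_measurable zeta /\
      (forall w, zeta 0 w = 0),
      (forall s t w, 0 <= s -> s <= t -> zeta s w <= zeta t w),
      (forall (n : nat) (t : nat -> R) (A : nat -> set R),
         0 <= t 0%N -> (forall i, (i < n)%N -> t i <= t i.+1) ->
         (forall i, measurable (A i)) ->
         Q (\bigcap_(i in [set i | (i < n)%N])
              [set w | A i (zeta (t i.+1) w - zeta (t i) w)]) =
         \big[*%E/1%E]_(i < n) Q [set w | A i (zeta (t i.+1) w - zeta (t i) w)]),
      (forall s h (A : set R), 0 <= s -> 0 <= h -> measurable A ->
         Q [set w | A (zeta (s + h) w - zeta s w)] = Q [set w | A (zeta h w)]) &
      (forall a lam, 0 <= a -> 0 <= lam ->
         (\int[Q]_w (expR (- (lam * zeta a w)))%:E = (expR (- (a * psi lam)))%:E)%E)].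

Definition Rsub (zeta : R -> T -> R) (u : R) (w : T) : R := expR (- zeta (ln u) w).

(* the new transition function:
   Pt(0,t,x,.) = P(0,t,x,.) (only x = 0 matters since X_0 = 0),
   Pt(s,t,x,dy) = E[ P(R_{t/s} t, t, (t/s)^kappa R_{t/s}^kappa x, dy) ],  0 < s <= t *)
Definition Ptilde (P : trfun) (kappa : R) (zeta : R -> T -> R) : trfun :=
  fun s t x A =>
    if s == 0 then P 0 t x A
    else (\int[Q]_w P (Rsub zeta (t / s) w * t)%R t
                     ((t / s) `^ kappa * (Rsub zeta (t / s) w) `^ kappa * x)%R A)%E.

End Process.

Definition transition_function (P : R -> R -> R -> probability R R) :=
  [/\ (forall (t : R) (A : set R), 0 <= t -> measurable A ->
         measurable_fun ([set s : R | 0 <= s <= t] `*` [set: R])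
                        (fun p : R * R => P p.1 t p.2 A)),
      (forall s x (A : set R), 0 <= s -> measurable A -> P s s x A = \d_x A) &
      (forall s u t x (A : set R), 0 <= s -> s <= u -> u <= t -> measurable A ->
         (P s t x A = \int[P s u x]_y P u t y A)%E)].

End Defs.

(* Main.v *)
Require Import Defs.
From HB Require Import structures.
From mathcomp Require Import all_boot all_order all_algebra.
From mathcomp Require Import all_classical all_reals all_analysis.
From mathcomp Require Import measurable_realfun lra.
Import Order.TTheory GRing.Theory Num.Theory.
Import numFieldNormedType.Exports.
Local Open Scope classical_set_scope.
Local Open Scope ring_scope.
Set Implicit Arguments. Unset Strict Implicit.

(** The Lamperti transform [Y_a = e^(-kappa a) Z_(e^a)] of [Z] is stationary.
    Time-change it by an independent two-sided subordinator [a] (the given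
    [zeta] on the positive half-line, the reflection of an independent copy on
    the negative one) and transform back:
    [X_t = t^kappa Y_(a (ln t)) = (t / e^(a (ln t)))^kappa Z_(e^(a (ln t)))].
    This is defined on an explicit product space, so no extension theorem is
    needed, and right-continuity of [Z] makes it measurable. Conditionally on
    [a], the Markov property and the self-similarity of [Z] give the transition
    from [X_s] to [X_t] as a function of [X_s] and of the increment
    [a (ln t) - a (ln s)], which is distributed as [zeta_(ln (t / s))].
    This increment is independent of the past of [X]: by stationarity of [Y] the
    law of that past given [a] depends only on the increments of [a] before
    [ln s]. Averaging over it gives the kernel of the theorem, and the
    martingale property follows in the same way. *)

(** [self_similar] constrains only the joint laws of [Z], so the kernel [P] inherits the scaling
    only outside null sets of the law of [Z s]. The argument therefore composes no kernels: every
    claim on [X] is an identity between integrals over events of its past, and the scaling of [P] is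
    used under such an integral. The time change has to be two-sided because [ln t] tends to minus
    infinity as [t] tends to 0. Being pinned at 0 at time 0, it has stationary increments but is not
    a stationary process, so the stationarity of the time-changed process [V], hence the
    self-similarity of [X], is not immediate. It follows from the Markov property: the law of [V v]
    does not depend on [v], and the kernel between two times depends only on their difference.
    Independence of the past takes Fubini twice: with the path of [a] fixed, stationarity of [Y]
    replaces the values of [a] by increments; with the path of [Z] fixed, only an event about these
    increments is left. Time 0 has no logarithm and is treated apart: [X 0] is 0 everywhere, [Z 0]
    only almost surely. *)

(** * Measure-theoretic tools: uniqueness, freezing, joint measurability, independence *)

Section rectangles.
Context {R : realType} {d1 d2 : measure_display}
  {S1 : measurableType d1} {S2 : measurableType d2}.
Local Open Scope ereal_scope.

Lemma rectangle_measure_unique (m1 m2 : {measure set (S1 * S2) -> \bar R}) :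
  m1 setT < +oo ->
  (forall A B, measurable A -> measurable B -> m1 (A `*` B) = m2 (A `*` B)) ->
  forall E, measurable E -> m1 E = m2 E.
Proof.
move=> m1oo m12 E mE.
pose G := [set A `*` B | A in @measurable _ S1 & B in @measurable _ S2].
apply: (measure_unique G (fun=> setT)) => //.
- exact: measurable_prod_measurableType.
- move=> _ _ [A mA [B mB <-]] [A' mA' [B' mB' <-]].
  exists (A `&` A'); first exact: measurableI.
  by exists (B `&` B'); [exact: measurableI|rewrite setXI].
- by move=> _; exists setT => //; exists setT => //; rewrite setXTT.
- by rewrite bigcup_const.
- by move=> _ [A mA [B mB <-]]; exact: m12.
Qed.

End rectangles.

Section freezing.
Context {R : realType} {d dS dS' d' : measure_display} {T : measurableType d}
  {S : measurableType dS} {S' : measurableType dS'} {T' : measurableType d'}.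
Variables (Q : probability T R) (Q' : probability T' R).
Variables (U : T -> S) (xi : T -> S') (eta : T' -> S').
Hypotheses (mU : measurable_fun setT U) (mxi : measurable_fun setT xi)
  (meta : measurable_fun setT eta).
Local Open Scope ereal_scope.

Hypothesis indep : forall A D, measurable A -> measurable D ->
  Q (U @^-1` A `&` xi @^-1` D) = Q (U @^-1` A) * Q' (eta @^-1` D).

(** [indep] contains two facts: [xi] is independent of [U], and [xi] has the law of [eta]. Hence the
    law of [(U, xi)] is the product of the laws of [U] and [eta], and Tonelli applies. *)
Lemma integral_freeze (h : S * S' -> \bar R) :
  measurable_fun setT h -> (forall x, 0 <= h x) ->
  \int[Q]_w h (U w, xi w) = \int[Q]_w \int[Q']_v h (U w, eta v).
Proof.
move=> mh h0.
have mUxi : measurable_fun setT (fun w => (U w, xi w)).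
  exact: measurable_fun_pair.
pose U' : {mfun T >-> S} := HB.pack U (isMeasurableFun.Build _ _ _ _ U mU).
pose eta' : {mfun T' >-> S'} :=
  HB.pack eta (isMeasurableFun.Build _ _ _ _ eta meta).
pose Uxi' : {mfun T >-> (S * S')%type} :=
  HB.pack (fun w => (U w, xi w)) (isMeasurableFun.Build _ _ _ _ _ mUxi).
have -> : \int[Q]_w h (U w, xi w) = \int[distribution Q Uxi']_z h z.
  by rewrite ge0_integral_distribution.
rewrite (@eq_measure_integral _ _ _ _ (distribution Q U' \x distribution Q' eta')).
  rewrite fubini_tonelli1//.
  rewrite ge0_integral_distribution//=; last 2 first.
  - exact: measurable_fun_fubini_tonelli_F.
  - by move=> x; exact: integral_ge0.
  apply: eq_integral => w _; rewrite /fubini_F.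
  rewrite ge0_integral_distribution//.
  exact: measurableT_comp.
move=> A mA _.
apply: (@rectangle_measure_unique _ _ _ _ _ (distribution Q Uxi')
  (distribution Q U' \x distribution Q' eta')) => //.
  by rewrite [X in X < _](@probability_setT _ _ _ (distribution Q Uxi')) ltry.
move=> B D mB mD; rewrite [RHS]product_measure1E//=.
by rewrite /distribution /pushforward/= -indep.
Qed.

End freezing.

Lemma exists_nondecreasing_enum (R : realType) (t : nat -> R) (n : nat) :
  exists tau : nat -> R, [/\ (forall i, tau i <= tau i.+1),
    (forall i, (i < n)%N -> exists2 j, (j < n)%N & tau j = t i) &
    (forall j, (j < n)%N -> exists2 i, (i < n)%N & tau j = t i)].
Proof.
pose s := sort <=%O [seq t i | i <- iota 0 n].
have szs : size s = n by rewrite size_sort size_map size_iota.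
have ss : sorted <=%O s by apply: sort_sorted; exact: le_total.
have sE x : (x \in s) = (x \in [seq t i | i <- iota 0 n]) by rewrite mem_sort.
(* Capping the index repeats the last entry for ever; plain [nth] would fall back to the default 0
   past the end and break monotonicity. *)
exists (fun i => nth 0 s (minn i n.-1)); split.
- move=> i; have [n0|n0] := posnP n.
    by rewrite !nth_default ?szs ?n0.
  have ltn k : (minn k n.-1 < n)%N by rewrite -{2}(prednK n0) ltnS geq_minr.
  apply: (le_sorted_leq_nth 0 ss); rewrite ?inE ?szs//.
  by rewrite leq_min geq_minr andbT (leq_trans (geq_minl _ _))//.
- move=> i ni.
  have tis : t i \in s by rewrite sE map_f// mem_iota.
  exists (index (t i) s); first by rewrite -szs index_mem.
  have := tis; rewrite -index_mem szs => itn.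
  by rewrite (minn_idPl _) ?nth_index// -ltnS prednK// (leq_ltn_trans _ ni).
- move=> j jn.
  have jn1 : (j <= n.-1)%N by rewrite -ltnS prednK// (leq_ltn_trans _ jn).
  rewrite (minn_idPl jn1).
  have : nth 0 s j \in s by rewrite mem_nth// szs.
  by rewrite sE => /mapP[i]; rewrite mem_iota add0n => /= ni ->; exists i.
Qed.

Section right_continuous_process.
Context {R : realType} {d : measure_display} {T : measurableType d}.

Lemma measurable_right_continuous (Y : R -> T -> R) :
  (forall t, measurable_fun setT (Y t)) ->
  (forall w t, (Y^~ w) @ t^'+ --> Y t w) ->
  measurable_fun setT (fun p : R * T => Y p.1 p.2).
Proof.
move=> mY cY.
(* The grid point of mesh [1 / n.+1] strictly to the right of [x]: right limits ignore the point
   itself, so rounding up has to be strict. *)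
pose r (n : nat) (x : R) : R := (Num.floor (n.+1%:R * x) + 1)%:~R / n.+1%:R.
apply: (@measurable_fun_cvg _ _ _ _ (fun n p => Y (r n p.1) p.2)).
- move=> n _ A mA; rewrite setTI.
  rewrite (_ : _ @^-1` _ = \bigcup_(k : int)
     ([set x : R | (k%:~R <= n.+1%:R * x) && (n.+1%:R * x < (k + 1)%:~R)] `*`
      (Y ((k + 1)%:~R / n.+1%:R) @^-1` A))).
    apply: countable_bigcupT_measurable => // k; apply: measurableX.
      have mn : measurable_fun setT (fun x : R => n.+1%:R * x).
        exact: measurable_funM.
      rewrite (_ : [set _ | _] =
          setT `&` (fun x : R => n.+1%:R * x) @^-1` `[k%:~R, (k + 1)%:~R[).
        by apply: mn => //; exact: measurable_itv.
      by apply/seteqP; split => x /=; rewrite in_itv/= => // -[].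
    by rewrite -[X in measurable X]setTI; exact: mY.
  apply/seteqP; split => [[x w]/= Aw|[x w] [k _ [/= kx Aw]]].
    exists (Num.floor (n.+1%:R * x)) => //; split => //=.
    exact: floor_itv.
  by rewrite /r (floor_def kx).
- move=> [x w] _ /=.
  have /cvg_at_rightP := cY w x; apply; split.
    by move=> n; rewrite /r ltr_pdivlMr// mulrC floorD1_gt.
  have h : (fun n => x + harmonic n) @ \oo --> x.
    rewrite -[X in _ --> X]addr0; apply: cvgD; first exact: cvg_cst.
    exact: cvg_harmonic.
  apply: squeeze_cvgr (cvg_cst x) h; near=> n.
  apply/andP; split; first by rewrite /r ler_pdivlMr// mulrC ltW// floorD1_gt.
  rewrite /r /harmonic ler_pdivrMr// mulrDl mulVf// intrD lerD2r (mulrC x).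
  by case/andP: (floor_itv (n.+1%:R * x)).
Unshelve. all: by end_near. Qed.

End right_continuous_process.

Section rectangle_independence.
Context {R : realType} {d d' d1 d2 : measure_display} {T : measurableType d}
  {T' : measurableType d'} {S1 : measurableType d1} {S2 : measurableType d2}.
Variables (Q : probability T R) (Q' : probability T' R) (B : set T).
Variables (xi : T -> S1 * S2) (eta : T' -> S1 * S2).
Hypotheses (mB : measurable B) (mxi : measurable_fun setT xi)
  (meta : measurable_fun setT eta).
Local Open Scope ereal_scope.

(** As functions of [E], both sides are finite measures: a restricted image of [Q] and a rescaled
    law of [eta]. *)
Lemma independent_from_rectangles :
  (forall A1 A2, measurable A1 -> measurable A2 ->
     Q (B `&` xi @^-1` (A1 `*` A2)) = Q B * Q' (eta @^-1` (A1 `*` A2))) ->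
  forall E, measurable E -> Q (B `&` xi @^-1` E) = Q B * Q' (eta @^-1` E).
Proof.
move=> QB E mE.
pose eta' : {mfun T' >-> (S1 * S2)%type} :=
  HB.pack eta (isMeasurableFun.Build _ _ _ _ _ meta).
have r0 : (0 <= fine (Q B))%R by rewrite fine_ge0.
have QBE : (fine (Q B))%:E = Q B by rewrite fineK// fin_num_measure.
pose m1 : {measure set (S1 * S2) -> \bar R} :=
  measure_function_pushforward__canonical__measure_function_Measure
    (mrestr Q mB) mxi.
pose m2 : {measure set (S1 * S2) -> \bar R} :=
  mscale (NngNum r0) (distribution Q' eta').
have m1E A : m1 A = Q (B `&` xi @^-1` A) by rewrite /m1/= /pushforward/= /mrestr setIC.
have m2E A : m2 A = Q B * Q' (eta @^-1` A).
  by rewrite /m2/= /mscale/= QBE.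
rewrite -m1E -m2E; apply: rectangle_measure_unique => //.
  rewrite m1E preimage_setT setIT.
  by rewrite (le_lt_trans (probability_le1 _ _)) ?ltry.
by move=> A1 A2 mA1 mA2; rewrite m1E m2E QB.
Qed.

End rectangle_independence.

Section pi_lambda_independence.
Context {R : realType} {d : measure_display} {T : measurableType d}.
Variables (Q : probability T R) (G : set (set T)) (E : set T) (q : \bar R).
Hypotheses (Gm : G `<=` measurable) (GI : setI_closed G) (GT : G setT)
  (mE : measurable E).
Local Open Scope ereal_scope.

Lemma independent_from_pi_system :
  (forall B, G B -> Q (B `&` E) = Q B * q) ->
  forall B, <<s G >> B -> Q (B `&` E) = Q B * q.
Proof.
move=> QE B GB.
(* The class contains [setT], which forces [q] to be the probability of [E], hence finite. *)
have qE : q = Q E by rewrite -[E]setTI QE// probability_setT mul1e.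
have r0 : (0 <= fine q)%R by rewrite qE fine_ge0.
have QEE : (fine q)%:E = q by rewrite qE fineK// fin_num_measure.
have -> : Q (B `&` E) = mrestr Q mE B by [].
have -> : Q B * q = mscale (NngNum r0) Q B by rewrite /mscale/= QEE muleC.
apply: (g_sigma_algebra_measure_unique G Gm (fun=> setT)) => //.
- by rewrite bigcup_const.
- by move=> A GA; rewrite /= /mrestr /mscale/= QE// QEE muleC.
- move=> _; rewrite /= /mrestr setTI.
  by rewrite (le_lt_trans (probability_le1 _ _)) ?ltry.
Qed.

End pi_lambda_independence.

(** * Cylinders and the increments of a subordinator *)

(** Convertible to the intersections in [self_similar] and [subordinator], so those hypotheses can
    be folded into this form. *)
Definition cylinder {R : realType} {T : Type} (n : nat) (Y : nat -> T -> R)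
    (A : nat -> set R) : set T :=
  \bigcap_(i in [set i | (i < n)%N]) [set w | A i (Y i w)].

Section cylinder.
Context {R : realType} {T : Type}.
Implicit Types (Y : nat -> T -> R) (A : nat -> set R).

Lemma cylinderS n Y A :
  cylinder n.+1 Y A = cylinder n Y A `&` [set w | A n (Y n w)].
Proof.
apply/seteqP; split => [w h|w [h hn] i /=].
  by split; [move=> i /= /ltnW ni; exact: h|exact: (h n (ltnSn n))].
by rewrite ltnS leq_eqVlt => /orP[/eqP ->|/h].
Qed.

Lemma cylinder0 Y A : cylinder 0 Y A = setT.
Proof. by apply/seteqP; split => // w _ i. Qed.

Lemma eq_cylinder n Y A Y' A' :
  (forall i w, (i < n)%N -> A i (Y i w) <-> A' i (Y' i w)) ->
  cylinder n Y A = cylinder n Y' A'.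
Proof.
move=> e; apply/seteqP; split => w h i /= ni.
  by apply/(e _ _ ni); exact: h.
by apply/(e _ _ ni); exact: h.
Qed.

Lemma cylinderT n Y : cylinder n Y (fun=> setT) = setT.
Proof. by apply/seteqP; split. Qed.

Lemma cylinderI n Y A A' :
  cylinder n Y A `&` cylinder n Y A' = cylinder n Y (fun i => A i `&` A' i).
Proof.
apply/seteqP; split => [w [h h'] i ni|w h]; first by split; [exact: h|exact: h'].
by split => i /h [].
Qed.

End cylinder.

Lemma measurable_cylinder {R : realType} {d : measure_display}
    {T : measurableType d} n (Y : nat -> T -> R) (A : nat -> set R) :
  (forall i, (i < n)%N -> measurable_fun setT (Y i)) ->
  (forall i, measurable (A i)) -> measurable (cylinder n Y A).
Proof.
move=> mY mA; apply: fin_bigcap_measurable; first exact: finite_II.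
by move=> i /= /mY mYi; rewrite -[X in measurable X]setTI; exact: mYi.
Qed.

Section independent_increments.
Context {R : realType} {d : measure_display} {T : measurableType d}.
Variables (Q : probability T R) (zeta : R -> T -> R) (psi : R -> R).
Hypothesis sub : subordinator Q zeta psi.
Local Open Scope ereal_scope.

Lemma subordinator_measurable t : (0 <= t)%R -> measurable_fun setT (zeta t).
Proof. by case: sub => -[mz _] _ _ _ _ /mz. Qed.

Lemma subordinator0 w : zeta 0%R w = 0%R.
Proof. by case: sub => -[_ ->]. Qed.

Lemma subordinator_le s t w : (0 <= s)%R -> (s <= t)%R -> (zeta s w <= zeta t w)%R.
Proof. by case: sub => _ + _ _ _; exact. Qed.

Lemma subordinator_ge0 t w : (0 <= t)%R -> (0 <= zeta t w)%R.
Proof. by move=> t0; rewrite -(subordinator0 w); exact: subordinator_le. Qed.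

Lemma subordinator_stationary s t A : (0 <= s)%R -> (s <= t)%R ->
  measurable A ->
  Q [set w | A (zeta t w - zeta s w)%R] = Q [set w | A (zeta (t - s)%R w)].
Proof.
case: sub => _ _ _ stat _ s0 st mA.
by rewrite -(stat s (t - s)%R)// ?subr_ge0// addrC subrK.
Qed.

Lemma increments_prod n (t : nat -> R) (A : nat -> set R) :
  (0 <= t 0%N)%R -> (forall i, (i < n)%N -> t i <= t i.+1)%R ->
  (forall i, measurable (A i)) ->
  Q (cylinder n (fun i w => zeta (t i.+1) w - zeta (t i) w)%R A) =
  \big[*%E/1%E]_(i < n) Q [set w | A i (zeta (t i.+1) w - zeta (t i) w)%R].
Proof. by case: sub => _ _ + _ _; exact. Qed.

(* The negative half of the two-sided subordinator runs backwards in time. *)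
Lemma decrements_prod n (t : nat -> R) (A : nat -> set R) :
  (0 <= t n)%R -> (forall i, (i < n)%N -> t i.+1 <= t i)%R ->
  (forall i, measurable (A i)) ->
  Q (cylinder n (fun i w => zeta (t i) w - zeta (t i.+1) w)%R A) =
  \big[*%E/1%E]_(i < n) Q [set w | A i (zeta (t i) w - zeta (t i.+1) w)%R].
Proof.
move=> tn0 tS mA.
pose t' i := t (n - i)%N; pose A' i := A (n - i.+1)%N.
have subK i : (i < n)%N -> (n - (n - i.+1))%N = i.+1 by move=> ni; rewrite subKn.
have subSK i : (i < n)%N -> (n - (n - i.+1).+1)%N = i.
  by move=> ni; rewrite subnSK// subKn// ltnW.
have subS i : (i < n)%N -> (n - i)%N = (n - i.+1).+1.
  by move=> ni; rewrite subnSK.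
transitivity (Q (cylinder n (fun i w => zeta (t' i.+1) w - zeta (t' i) w)%R A')).
  congr (Q _); apply/seteqP; split => w h i /= ni.
    rewrite /A' /t' (subS _ ni).
    by apply: (h (n - i.+1)%N); rewrite /= -subS// leq_subr.
  have := h (n - i.+1)%N; rewrite /A' /t'/= subK// subSK//; apply.
  by rewrite -subS// leq_subr.
rewrite increments_prod; last 3 first.
- by rewrite /t' subn0.
- move=> i ni; rewrite /t' (subS _ ni); apply: tS.
  by rewrite -subS// leq_subr.
- by move=> i; exact: mA.
rewrite (reindex_inj rev_ord_inj)/=; apply: eq_bigr => i _.
by rewrite /A' /t' subK// subSK.
Qed.

(** With [D] as constraint number [n], the intersection is itself a cylinder, whose product formula
    has one more factor. *)
Let independent_last n (I : nat -> T -> R) (A : nat -> set R) (D : set R) :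
  (forall m A, (m <= n.+1)%N -> (forall i, measurable (A i)) ->
     Q (cylinder m I A) = \big[*%E/1%E]_(i < m) Q [set w | A i (I i w)]) ->
  (forall i, measurable (A i)) -> measurable D ->
  Q (cylinder n I A `&` [set w | D (I n w)]) =
  Q (cylinder n I A) * Q [set w | D (I n w)].
Proof.
move=> prodE mA mD.
pose A' i := if (i < n)%N then A i else D.
have mA' i : measurable (A' i) by rewrite /A'; case: ifP.
have cE : cylinder n I A = cylinder n I A'.
  by apply: eq_cylinder => i w ni; rewrite /A' ni.
have DE : D = A' n by rewrite /A' ltnn.
by rewrite cE {1 2}DE -cylinderS !prodE// big_ord_recr.
Qed.

Lemma increments_independent n (t : nat -> R) (A : nat -> set R) D :
  (0 <= t 0%N)%R -> (forall i, t i <= t i.+1)%R ->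
  (forall i, measurable (A i)) -> measurable D ->
  Q (cylinder n (fun i w => zeta (t i.+1) w - zeta (t i) w)%R A `&`
     [set w | D (zeta (t n.+1) w - zeta (t n) w)%R]) =
  Q (cylinder n (fun i w => zeta (t i.+1) w - zeta (t i) w)%R A) *
  Q [set w | D (zeta (t n.+1 - t n)%R w)].
Proof.
move=> t0 tS mA mD.
have tn0 : (0 <= t n)%R by elim: n => // n /le_trans; apply.
rewrite -(@subordinator_stationary (t n))//.
apply: (@independent_last n (fun i w => zeta (t i.+1) w - zeta (t i) w)%R) => //.
by move=> m A' _ mA'; exact: increments_prod.
Qed.

Lemma decrements_independent n (t : nat -> R) (A : nat -> set R) D :
  (forall i, 0 <= t i)%R -> (forall i, t i.+1 <= t i)%R ->
  (forall i, measurable (A i)) -> measurable D ->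
  Q (cylinder n (fun i w => zeta (t i) w - zeta (t i.+1) w)%R A `&`
     [set w | D (zeta (t n) w - zeta (t n.+1) w)%R]) =
  Q (cylinder n (fun i w => zeta (t i) w - zeta (t i.+1) w)%R A) *
  Q [set w | D (zeta (t n - t n.+1)%R w)].
Proof.
move=> t0 tS mA mD.
rewrite -(@subordinator_stationary (t n.+1))//.
apply: (@independent_last n (fun i w => zeta (t i) w - zeta (t i.+1) w)%R) => //.
by move=> m A' _ mA'; exact: decrements_prod.
Qed.

End independent_increments.

(** * The two-sided subordinator and the independence of its increments *)

(** For a subordinator one of the two terms is [zeta 0 = 0]. Without a case split on the sign of
    [v], every increment is the sum of an increment of each copy, also when the interval straddles
    0. *)
Definition two_sided {R : realType} {T : Type} (zeta : R -> T -> R)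
    (v : R) (w : T * T) : R :=
  zeta (Num.max v 0) w.1 - zeta (Num.max (- v) 0) w.2.

Section two_sided_subordinator.
Context {R : realType} {d : measure_display} {T : measurableType d}.
Variables (Q : probability T R) (zeta : R -> T -> R) (psi : R -> R).
Hypothesis sub : subordinator Q zeta psi.
Local Notation a := (two_sided zeta).
Local Open Scope ereal_scope.

Let max0 (x : R) : (0 <= Num.max x 0)%R. Proof. by rewrite le_max lexx orbT. Qed.
Let mz t : (0 <= t)%R -> measurable_fun setT (zeta t).
Proof. exact: (subordinator_measurable sub). Qed.

Lemma two_sided_le u v w : (u <= v)%R -> (a u w <= a v w)%R.
Proof.
move=> uv; rewrite /two_sided lerB//.
  by apply: (subordinator_le sub) => //; exact: le_max2.
by apply: (subordinator_le sub) => //; apply: le_max2 => //; rewrite lerN2.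
Qed.

Lemma measurable_two_sided v : measurable_fun setT (a v).
Proof.
apply: measurable_funB.
  by apply: measurableT_comp; [exact: mz|exact: measurable_fst].
by apply: measurableT_comp; [exact: mz|exact: measurable_snd].
Qed.

Section grid.
Variable v : nat -> R.
Hypothesis vS : forall i, (v i <= v i.+1)%R.

Let I1 (i : nat) (w : T) : R :=
  (zeta (Num.max (v i.+1) 0) w - zeta (Num.max (v i) 0) w)%R.
Let I2 (i : nat) (w : T) : R :=
  (zeta (Num.max (- v i) 0) w - zeta (Num.max (- v i.+1) 0) w)%R.

Let mI1 i : measurable_fun setT (I1 i).
Proof. by apply: measurable_funB; exact: mz. Qed.
Let mI2 i : measurable_fun setT (I2 i).
Proof. by apply: measurable_funB; exact: mz. Qed.

(** Increments of the two copies are constrained separately: this makes the class closed under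
    intersection and lets the product measure factor. [I2] consists of increments of the second
    copy, since its times decrease. *)
Definition grid_rectangles (n : nat) : set (set (T * T)) :=
  [set S | exists A B, [/\ (forall i, measurable (A i)),
     (forall i, measurable (B i)) &
     S = cylinder n I1 A `*` cylinder n I2 B]].

Let grid_measurable n : grid_rectangles n `<=` measurable.
Proof.
by move=> _ [A [B [mA mB ->]]]; apply: measurableX; exact: measurable_cylinder.
Qed.

Let grid_setI n : setI_closed (grid_rectangles n).
Proof.
move=> _ _ [A [B [mA mB ->]]] [A' [B' [mA' mB' ->]]].
exists (fun i => A i `&` A' i), (fun i => B i `&` B' i); split.
- by move=> i; exact: measurableI.
- by move=> i; exact: measurableI.
- by rewrite -!cylinderI setXI.
Qed.

Let grid_setT n : grid_rectangles n setT.
Proof. by exists (fun=> setT), (fun=> setT); rewrite !cylinderT setXTT. Qed.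

(** The next increment of [a] is [I1 n + I2 n], where the two terms are independent of each other
    and of the earlier increments of both copies. *)
Lemma grid_independent n S D : <<s grid_rectangles n >> S -> measurable D ->
  (Q \x Q) (S `&` [set w | D (a (v n.+1) w - a (v n) w)%R]) =
  (Q \x Q) S * Q [set w | D (zeta (v n.+1 - v n)%R w)].
Proof.
move=> GS mD.
have mE : measurable [set w | D (a (v n.+1) w - a (v n) w)%R].
  have m : measurable_fun setT (fun w => a (v n.+1) w - a (v n) w)%R.
    by apply: measurable_funB; exact: measurable_two_sided.
  by rewrite -[X in measurable X]setTI; exact: m.
apply: (@independent_from_pi_system _ _ _ (Q \x Q) (grid_rectangles n)) => //.
move=> {GS} _ [A [B [mA mB ->]]].
pose p := (Num.max (v n.+1) 0 - Num.max (v n) 0)%R.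
pose q := (Num.max (- v n) 0 - Num.max (- v n.+1) 0)%R.
have p0 : (0 <= p)%R by rewrite subr_ge0 le_max2.
have q0 : (0 <= q)%R by rewrite subr_ge0 le_max2// lerN2.
have maxB (x : R) : (Num.max x 0 - Num.max (- x) 0)%R = x.
  by rewrite /Order.max; case: ltP => ?; case: ltP => ?; lra.
have pq : (v n.+1 - v n = p + q)%R.
  by rewrite -{1}(maxB (v n.+1)) -{1}(maxB (v n)) /p /q; lra.
pose E := [set x : R * R | D (x.1 + x.2)%R].
have mE2 : measurable E.
  have m : measurable_fun setT (fun x : R * R => x.1 + x.2)%R.
    by apply: measurable_funD; [exact: measurable_fst|exact: measurable_snd].
  by rewrite -[X in measurable X]setTI; exact: m.
pose xi (w : T * T) := (I1 n w.1, I2 n w.2).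
(* Two successive increments of one copy have the joint law of [xi], and their sum telescopes to
   [zeta] at the full length [p + q]. *)
pose eta w := (zeta p w, zeta (p + q)%R w - zeta p w)%R.
have xiE w : (a (v n.+1) w - a (v n) w = (xi w).1 + (xi w).2)%R.
  by rewrite /two_sided /xi /I1 /I2/=; lra.
have -> : [set w | D (a (v n.+1) w - a (v n) w)%R] = xi @^-1` E.
  by apply/seteqP; split => w /=; rewrite xiE.
have -> : [set w | D (zeta (v n.+1 - v n)%R w)] = eta @^-1` E.
  have etaE w : ((eta w).1 + (eta w).2)%R = zeta (p + q)%R w.
    by rewrite /eta/= addrC subrK.
  by rewrite pq; apply/seteqP; split => w; rewrite /E/= etaE.
apply: (@independent_from_rectangles _ _ _ _ _ _ _ _ _ (Q \x Q)) => //.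
- by apply: measurableX; exact: measurable_cylinder.
- by apply: measurable_fun_pair; apply: measurableT_comp.
- apply: measurable_fun_pair; first exact: mz.
  by apply: measurable_funB; apply: mz => //; exact: addr_ge0.
move=> A1 A2 mA1 mA2.
have -> : (cylinder n I1 A `*` cylinder n I2 B) `&` xi @^-1` (A1 `*` A2) =
    (cylinder n I1 A `&` [set w | A1 (I1 n w)]) `*`
    (cylinder n I2 B `&` [set w | A2 (I2 n w)]).
  by apply/seteqP; split => [[x y]/= [[? ?] [? ?]]|[x y]/= [[? ?] [? ?]]].
have mc1 : measurable (cylinder n I1 A) by exact: measurable_cylinder.
have mc2 : measurable (cylinder n I2 B) by exact: measurable_cylinder.
have mi1 : measurable [set w | A1 (I1 n w)].
  by rewrite -[X in measurable X]setTI; exact: mI1.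
have mi2 : measurable [set w | A2 (I2 n w)].
  by rewrite -[X in measurable X]setTI; exact: mI2.
rewrite [LHS]product_measure1E; [|exact: measurableI|exact: measurableI].
rewrite [X in _ = X * _]product_measure1E//.
have inc1 : Q (cylinder n I1 A `&` [set w | A1 (I1 n w)]) =
    Q (cylinder n I1 A) * Q [set w | A1 (zeta p w)].
  apply: (@increments_independent _ _ _ _ _ _ sub n (fun i => Num.max (v i) 0%R)) => //.
  by move=> i; exact: le_max2.
have inc2 : Q (cylinder n I2 B `&` [set w | A2 (I2 n w)]) =
    Q (cylinder n I2 B) * Q [set w | A2 (zeta q w)].
  apply: (@decrements_independent _ _ _ _ _ _ sub n (fun i => Num.max (- v i)%R 0%R)) => //.
  by move=> i; rewrite le_max2// lerN2.
rewrite [X in X * _ = _]inc1 [X in _ * X = _]inc2.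
have -> : Q (eta @^-1` (A1 `*` A2)) =
    Q [set w | A1 (zeta p w)] * Q [set w | A2 (zeta q w)].
  (* The times 0, [p], [p + q], constant afterwards because monotonicity is required at every
     index. *)
  pose t i := if i is j.+1 then if j is k.+1 then (p + q)%R else p else 0%R.
  have tS i : (t i <= t i.+1)%R by case: i => [|[|i]]//=; rewrite ?lerDl.
  have pqp : (p <= p + q)%R by rewrite lerDl.
  have e : [set w | A1 (zeta p w - zeta 0 w)%R] = [set w | A1 (zeta p w)].
    by apply/seteqP; split => w /=; rewrite (subordinator0 sub) subr0.
  have := @increments_independent _ _ _ _ _ _ sub 1 t (fun=> A1) A2.
  rewrite !cylinderS !cylinder0 !setTI => /(_ (lexx _) tS (fun=> mA1) mA2).
  by rewrite /= e (_ : p + q - p = q)%R//; lra.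
by rewrite -!muleA; congr *%E; rewrite muleCA.
Qed.

End grid.
End two_sided_subordinator.

Section two_sided_independence.
Context {R : realType} {d : measure_display} {T : measurableType d}.
Variables (Q : probability T R) (zeta : R -> T -> R) (psi : R -> R).
Hypothesis sub : subordinator Q zeta psi.
Local Notation a := (two_sided zeta).
Local Open Scope ereal_scope.

Lemma measurable_grid_increment (v : nat -> R) n k : (k < n)%N ->
  measurable_fun setT (fun w : g_sigma_algebraType (grid_rectangles zeta v n) =>
    a (v k.+1) w - a (v k) w)%R.
Proof.
move=> kn; pose G := grid_rectangles zeta v n.
pose AT (A : set R) i := if i == k then A else setT.
have mAT A : measurable A -> forall i, measurable (AT A i).
  by move=> mA i; rewrite /AT; case: ifP.
have cE (Y : nat -> T -> R) A : cylinder n Y (AT A) = [set w | A (Y k w)].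
  apply/seteqP; split => [w /(_ k kn)|w Aw i ni]/=; first by rewrite /AT eqxx.
  by rewrite /AT; case: ifPn => // /eqP ->.
have m1 : measurable_fun setT (fun w : g_sigma_algebraType G =>
    zeta (Num.max (v k.+1) 0) w.1 - zeta (Num.max (v k) 0) w.1)%R.
  move=> _ A mA; rewrite setTI; apply: sub_sigma_algebra.
  exists (AT A), (fun=> setT); split; [exact: mAT|by []|].
  by rewrite cE cylinderT setXT.
have m2 : measurable_fun setT (fun w : g_sigma_algebraType G =>
    zeta (Num.max (- v k) 0) w.2 - zeta (Num.max (- v k.+1) 0) w.2)%R.
  move=> _ A mA; rewrite setTI; apply: sub_sigma_algebra.
  exists (fun=> setT), (AT A); split; [by []|exact: mAT|].
  by rewrite cE cylinderT setTX.
apply: eq_measurable_fun (measurable_funD m1 m2) => w _.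
by rewrite /two_sided/=; lra.
Qed.

(* Only the increments before [v] are independent of the one after it: for
   [u < v < 0] the value [a u] itself is determined by later increments. *)
Lemma two_sided_independent n (u : nat -> R) (v v' : R) (A : nat -> set R) D :
  (v <= v')%R -> (forall i, (i < n)%N -> u i <= v)%R ->
  (forall i, measurable (A i)) -> measurable D ->
  (Q \x Q) (cylinder n (fun i w => a (u i) w - a v w)%R A `&`
            [set w | D (a v' w - a v w)%R]) =
  (Q \x Q) (cylinder n (fun i w => a (u i) w - a v w)%R A) *
  Q [set w | D (zeta (v' - v)%R w)].
Proof.
move=> vv' uv mA mD.
have [tau [tauS utau tauu]] := exists_nondecreasing_enum u n.
(* The sorted times [u], then [v] at index [n] and [v'] from [n.+1] on, so that increment number [n]
   of the grid is the one after [v]. *)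
pose c i := if (i < n)%N then tau i else if i == n then v else v'.
have cn : c n = v by rewrite /c ltnn eqxx.
have cn1 : c n.+1 = v' by rewrite /c ltnNge leqnSn/= (gtn_eqF (ltnSn n)).
have cS i : (c i <= c i.+1)%R.
  rewrite /c; case: (ltngtP i n) => [ni|ni|->].
  - case: (ltngtP i.+1 n) => [ni1|ni1|ni1].
    + exact: tauS.
    + by move: ni1; rewrite ltnS leqNgt ni.
    + by have [j jn ->] := tauu _ ni; exact: uv.
  - by rewrite ltnNge ltnW ?(ltn_trans ni)//= (gtn_eqF (ltn_trans ni (ltnSn i))).
  - by rewrite ltnNge leqnSn/= (gtn_eqF (ltnSn n)).
have := @grid_independent _ _ _ _ _ _ sub c cS n _ D _ mD.
rewrite cn cn1; apply.
pose GT := g_sigma_algebraType (grid_rectangles zeta c n).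
(* The difference telescopes into grid increments, collected backwards from [v]. *)
have mc k : (k <= n)%N -> measurable_fun setT (fun w : GT => a (c (n - k)%N) w - a v w)%R.
  elim: k => [_|k IH kn].
    apply: eq_measurable_fun (@measurable_cst _ _ GT R setT 0%R) => w _.
    by rewrite subn0 cn subrr.
  apply: eq_measurable_fun (measurable_funB (IH (ltnW kn))
    (@measurable_grid_increment c n (n - k.+1)%N _)) => [w _|].
    by rewrite /= subnSK//; lra.
  by rewrite -subSn// subSS leq_subr.
apply: (@measurable_cylinder _ _ GT) => // i ni.
have [j jn jE] := utau _ ni.
have -> : u i = c (n - (n - j))%N by rewrite (subKn (ltnW jn)) /c jn jE.
by apply: mc; rewrite leq_subr.
Qed.

End two_sided_independence.

(** * Scaling of the process [Z] and of its transition function *)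

Lemma nat_filtration_measurable {R : realType} {d : measure_display}
    {T : measurableType d} (Y : R -> T -> R) s :
  process_measurable Y -> nat_filtration Y s `<=` measurable.
Proof.
move=> mY; apply: smallest_sub; first exact: sigma_algebra_measurable.
move=> _ [u [A [/andP[u0 _] mA ->]]].
by rewrite -[X in measurable X]setTI; exact: mY.
Qed.

Lemma nat_filtration_setT {R : realType} {d : measure_display}
    {T : measurableType d} (Y : R -> T -> R) s : nat_filtration Y s setT.
Proof.
have [z1 z2 _] := smallest_sigma_algebra setT [set B | exists u (A : set R),
  [/\ 0 <= u <= s, measurable A & B = Y u @^-1` A]].
by have := z2 _ z1; rewrite setD0.
Qed.

Lemma preimage_fun_measurable {R : realType} {d : measure_display}
    {T : measurableType d} (f : T -> R) (A : set R) :
  measurable_fun setT f -> measurable A -> measurable [set w | A (f w)].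
Proof. by move=> mf mA; rewrite -[X in measurable X]setTI; exact: mf. Qed.

Lemma measurable_neq0 {R : realType} {d : measure_display}
    {T : measurableType d} (f : T -> R) :
  measurable_fun setT f -> measurable [set w | f w != 0].
Proof.
move=> mf; rewrite (_ : [set w | _] = [set w | (~` [set 0]) (f w)]).
  by apply: preimage_fun_measurable => //; exact: measurableC.
by apply/seteqP; split => w /= /eqP.
Qed.

Section transition.
Context {R : realType}.
Variable P : R -> R -> R -> probability R R.
Hypothesis trP : transition_function P.

Lemma measurable_transition {d : measure_display} {S : measurableType d}
    (r x : S -> R) (t : R) (A : set R) : 0 <= t -> measurable A ->
  measurable_fun setT r -> measurable_fun setT x ->
  (forall w, 0 <= r w <= t) ->
  measurable_fun setT (fun w => P (r w) t (x w) A).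
Proof.
move=> t0 mA mr mx rt; case: trP => mP _ _.
have m0t : measurable [set s : R | 0 <= s <= t].
  rewrite (_ : [set s : R | 0 <= s <= t] = `[0, t]%classic); first exact: measurable_itv.
  by apply/seteqP; split => y /=; rewrite in_itv.
apply: (@measurable_comp _ _ _ _ _ _ ([set s : R | 0 <= s <= t] `*` [set: R])
  (fun p : R * R => P p.1 t p.2 A) setT (fun w => (r w, x w))).
- exact: measurableX.
- by move=> _ [w _ <-]; split => //=.
- exact: mP.
- exact: measurable_fun_pair.
Qed.

End transition.

Section self_similar_process.
Context {R : realType} {d : measure_display} {T : measurableType d}.
Variables (PZ : probability T R) (kappa : R) (Z : R -> T -> R).
Hypotheses (mZ : process_measurable Z) (ssZ : self_similar PZ kappa Z).
Local Open Scope ereal_scope.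

Lemma self_similar1 c t A : (0 < c)%R -> (0 <= t)%R -> measurable A ->
  PZ [set w | A (Z (c * t)%R w)] = PZ [set w | A (c `^ kappa * Z t w)%R].
Proof.
move=> c0 t0 mA.
have := @ssZ c c0 1%N (fun=> t) (fun=> A) (fun=> t0) (fun=> mA).
rewrite -/(cylinder 1 (fun i w => Z (c * t)%R w) (fun=> A)).
rewrite -/(cylinder 1 (fun i w => c `^ kappa * Z t w)%R (fun=> A)).
by rewrite !cylinderS !cylinder0 !setTI.
Qed.

Lemma self_similar2 c s t A B : (0 < c)%R -> (0 <= s)%R -> (0 <= t)%R ->
  measurable A -> measurable B ->
  PZ ([set w | A (Z (c * s)%R w)] `&` [set w | B (Z (c * t)%R w)]) =
  PZ ([set w | A (c `^ kappa * Z s w)%R] `&` [set w | B (c `^ kappa * Z t w)%R]).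
Proof.
move=> c0 s0 t0 mA mB.
pose u i := if i is 0%N then s else t.
pose D i := if i is 0%N then A else B.
have u0 i : (0 <= u i)%R by case: i.
have mD i : measurable (D i) by case: i.
have := @ssZ c c0 2%N u D u0 mD.
rewrite -/(cylinder 2 (fun i w => Z (c * u i)%R w) D).
rewrite -/(cylinder 2 (fun i w => c `^ kappa * Z (u i) w)%R D).
by rewrite !cylinderS !cylinder0 !setTI.
Qed.

(** Time 0 is fixed by scaling, so the tail of [Z 0] beyond [r] has the same probability for all
    positive [r]. Letting [r] grow shows that this constant is 0; letting [r] decrease to 0 exhausts
    the event. *)
Lemma self_similar_initial : (0 < kappa)%R -> PZ [set w | Z 0%R w != 0%R] = 0.
Proof.
move=> k0.
pose F (r : R) := [set w | `|Z 0%R w| > r]%R.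
have mball (r : R) : measurable [set x : R | `|x| > r]%R.
  have : measurable_fun setT (fun x : R => `|x|%R) by exact: normr_measurable.
  move=> /preimage_fun_measurable /(_ (measurable_itv `]r, +oo[)).
  by rewrite (_ : [set x : R | _] = [set x : R | `|x| > r]%R)//;
    apply/seteqP; split => x /=; rewrite in_itv/= andbT.
have mF r : measurable (F r).
  by apply: (preimage_fun_measurable _ (mball r)); exact: mZ.
have FE (r : R) : (0 < r)%R -> PZ (F r) = PZ (F 1%R).
  move=> r0; pose c := (r^-1 `^ kappa^-1)%R.
  have c0 : (0 < c)%R by rewrite powR_gt0// invr_gt0.
  have ck : (c `^ kappa = r^-1)%R.
    by rewrite /c -powRrM mulVf ?gt_eqF// powRr1// invr_ge0 ltW.
  have := self_similar1 c0 (lexx 0%R) (mball 1%R); rewrite mulr0 ck => /= ss1.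
  rewrite [RHS]ss1; congr (PZ _); apply/seteqP; split => w;
    by rewrite /F/= normrM gtr0_norm ?invr_gt0// mulrC ltr_pdivlMr// mul1r.
have F10 : PZ (F 1%R) = 0.
  have cF : (fun n : nat => PZ (F n.+1%:R)) @ \oo --> PZ (\bigcap_n F n.+1%:R).
    apply: nonincreasing_cvg_mu => //.
    - by rewrite (le_lt_trans (probability_le1 _ _)) ?ltry.
    - exact: bigcapT_measurable.
    - move=> m n mn; apply/subsetPset => w /=; apply: le_lt_trans.
      by rewrite ler_nat.
  rewrite (_ : \bigcap_n _ = set0) ?measure0 in cF; last first.
    apply/seteqP; split => // w /= /(_ (Num.truncn `|Z 0%R w|)) /(_ Logic.I).
    by rewrite /F/= ltNge ltW// truncnS_gt.
  apply: (cvg_unique _ _ cF) => //.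
  rewrite (_ : (fun _ => _) = cst (PZ (F 1%R))); first exact: cvg_cst.
  by apply/funext => n; rewrite FE.
have cF : (fun n : nat => PZ (F (n.+1%:R^-1)%R)) @ \oo --> PZ (\bigcup_n F (n.+1%:R^-1)%R).
  apply: nondecreasing_cvg_mu => //; first exact: bigcupT_measurable.
  move=> m n mn; apply/subsetPset => w /=; apply: le_lt_trans.
  by rewrite lef_pV2 ?posrE// ler_nat.
rewrite (_ : [set w | _] = \bigcup_n F (n.+1%:R^-1)%R).
  apply/esym; apply: (cvg_unique _ _ cF) => //.
  rewrite (_ : (fun _ => _) = cst 0); first exact: cvg_cst.
  by apply/funext => n; rewrite FE// invr_gt0.
apply/seteqP; split => [w /=|w [n _]].
  by rewrite -normr_gt0 => /ltr_add_invr[n]; rewrite add0r => h; exists n.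
by rewrite /F/= -normr_gt0; apply: lt_trans.
Qed.

Variable P : R -> R -> R -> probability R R.
Hypotheses (trP : transition_function P)
  (mkZ : markov_with PZ Z (fun s t x A => P s t x A)).

(* Self-similarity of [Z] yields that of [P] only up to [Z_s]-null sets. *)
Lemma markov_rescaled s t c C A : (0 <= s)%R -> (s <= t)%R -> (0 < c)%R ->
  nat_filtration Z s C -> measurable A ->
  PZ (C `&` [set w | A (c `^ kappa * Z t w)%R]) =
  \int[PZ]_(w in C) P (c * s)%R (c * t)%R (c `^ kappa * Z s w)%R A.
Proof.
move=> s0 st c0 FC mA.
have t0 : (0 <= t)%R by exact: le_trans st.
have mC := nat_filtration_measurable mZ FC.
have mcx : measurable_fun setT (fun x : R => c `^ kappa * x)%R.
  exact: measurable_funM.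
pose A' := [set x | A (c `^ kappa * x)%R].
have mA' : measurable A' by exact: preimage_fun_measurable.
pose f x := P s t x A'.
pose g x := P (c * s)%R (c * t)%R (c `^ kappa * x)%R A.
have cs0 : (0 <= c * s)%R by rewrite mulr_ge0// ltW.
have ct0 : (0 <= c * t)%R by rewrite mulr_ge0// ltW.
have csct : (c * s <= c * t)%R by rewrite ler_pM2l.
have mf : measurable_fun setT f.
  by apply: (measurable_transition trP) => // w; rewrite s0 st.
have mP' : measurable_fun setT (fun x => P (c * s)%R (c * t)%R x A).
  by apply: (measurable_transition trP) => // w; rewrite cs0 csct.
have mg : measurable_fun setT g by exact: (measurableT_comp mP').
pose Zs : {mfun T >-> R} := HB.pack (Z s) (isMeasurableFun.Build _ _ _ _ _ (mZ s0)).
pose Zcs : {mfun T >-> R} :=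
  HB.pack (Z (c * s)%R) (isMeasurableFun.Build _ _ _ _ _ (mZ cs0)).
have mcZs : measurable_fun setT (fun w => c `^ kappa * Z s w)%R.
  by apply: (measurableT_comp mcx); exact: mZ.
pose cZs : {mfun T >-> R} :=
  HB.pack (fun w => c `^ kappa * Z s w)%R (isMeasurableFun.Build _ _ _ _ _ mcZs).
(* Compare integrals over Borel sets. The Markov property at [(s, t)] and at [(c * s, c * t)] turns
   them into probabilities for the two pairs of values of [Z], which [self_similar2] identifies. *)
have fg : ae_eq (distribution PZ Zs) setT f g.
  apply: integral_ae_eq => //.
    apply: (@le_integrable _ _ _ (distribution PZ Zs) setT measurableT _ (cst 1)) => //.
      move=> x _; rewrite /f /cst/= gee0_abs// normr1.
      exact: probability_le1.
    apply/integrableP; split => //; rewrite /= normr1 integral_cst//= mul1e.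
    by rewrite [X in X < _](@probability_setT _ _ _ (distribution PZ Zs)) ltry.
  move=> E _ mE.
  pose E' := [set x | E ((c `^ kappa)^-1 * x)%R].
  have ck : (c `^ kappa != 0)%R by rewrite gt_eqF// powR_gt0.
  have mE' : measurable E'.
    by apply: preimage_fun_measurable => //; exact: measurable_funM.
  have EE' : [set w | E' (c `^ kappa * Z s w)%R] = [set w | E (Z s w)].
    by apply/seteqP; split => w /=; rewrite /E'/= mulrA mulVf// mul1r.
  transitivity (\int[PZ]_(w in Z s @^-1` E) f (Z s w)).
    by rewrite ge0_integral_pushforward//; exact: measurable_funTS.
  rewrite -mkZ//; last first.
    by apply: sub_sigma_algebra; exists s, E; rewrite s0 lexx.
  transitivity (PZ ([set w | E' (c `^ kappa * Z s w)%R] `&`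
                    [set w | A (c `^ kappa * Z t w)%R])).
    by rewrite EE'.
  rewrite -self_similar2//.
  transitivity (\int[PZ]_(w in Z (c * s)%R @^-1` E')
                  P (c * s)%R (c * t)%R (Z (c * s)%R w) A).
    apply: mkZ => //; apply: sub_sigma_algebra; exists (c * s)%R, E'.
    by rewrite cs0 lexx.
  transitivity (\int[distribution PZ Zcs]_(x in E') P (c * s)%R (c * t)%R x A).
    by rewrite ge0_integral_pushforward//; exact: measurable_funTS.
  transitivity (\int[distribution PZ cZs]_(x in E') P (c * s)%R (c * t)%R x A).
    by apply: eq_measure_integral => B mB _; exact: self_similar1.
  rewrite ge0_integral_pushforward//; last exact: measurable_funTS.
  rewrite ge0_integral_pushforward//; last exact: measurable_funTS.
  by rewrite /preimage/= EE'.
transitivity (\int[PZ]_(w in C) f (Z s w)); first exact: mkZ.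
apply: ae_eq_integral => //.
- by apply: measurable_funTS; apply: measurableT_comp => //; exact: mZ.
- by apply: measurable_funTS; apply: (measurableT_comp mg); exact: mZ.
- case: fg => N [mN N0 fgN].
  exists (Z s @^-1` N); split => //.
    by rewrite -[X in measurable X]setTI; exact: mZ.
  move=> w /= h; apply: fgN => /= h'; apply: h => _; exact: h'.
Qed.

End self_similar_process.

(** * The product space and the Lamperti transform *)

Definition product_prob {R : realType} {d d' : measure_display}
    {T : measurableType d} {W : measurableType d'} (P : probability T R)
    (Q : probability W R) : probability (T * W)%type R := (P \x Q)%E.

Section product_prob.
Context {R : realType} {d d' : measure_display} {T : measurableType d}
  {W : measurableType d'}.
Variables (P : probability T R) (Q : probability W R).
Local Open Scope ereal_scope.

Lemma product_prob_xsections S : measurable S ->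
  product_prob P Q S = \int[P]_w Q [set v | S (w, v)].
Proof.
move=> mS; apply: eq_integral => w _ /=; congr (Q _).
by apply/seteqP; split => v; rewrite /xsection/= inE.
Qed.

Lemma product_prob_ysections S : measurable S ->
  product_prob P Q S = \int[Q]_v P [set w | S (w, v)].
Proof.
move=> mS; rewrite /product_prob/=.
rewrite (@product_measure_unique _ _ _ _ _ P Q (P \x^ Q))//; last first.
  by move=> *; exact: product_measure2E.
apply: eq_integral => w _ /=; congr (P _).
by apply/seteqP; split => v; rewrite /ysection/= inE.
Qed.

Lemma measurable_xsections (S : set (T * W)) : measurable S ->
  measurable_fun setT (fun w => Q [set v | S (w, v)]).
Proof.
move=> mS; apply: eq_measurable_fun (measurable_fun_xsection Q mS) => w _ /=.
congr (Q _).
by apply/seteqP; split => v; rewrite /xsection/= inE.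
Qed.

Lemma ge0_integral_product_prob (f : T * W -> \bar R) :
  measurable_fun setT f -> (forall p, 0 <= f p) ->
  \int[product_prob P Q]_p f p = \int[Q]_v \int[P]_w f (w, v).
Proof. exact: fubini_tonelli2. Qed.

Lemma integral_product_prob (f : T * W -> \bar R) :
  (product_prob P Q).-integrable setT f ->
  \int[product_prob P Q]_p f p = \int[Q]_v \int[P]_w f (w, v).
Proof. by move=> intf; rewrite -(@integral21_prod_meas1 _ _ _ _ _ P Q f intf). Qed.

End product_prob.

Lemma expR_powR (R : realType) (b k : R) : (expR b) `^ k = expR (k * b).
Proof. by rewrite /powR gt_eqF ?expR_gt0// expRK. Qed.

Definition lamperti {R : realType} {T : Type} (kappa : R) (Z : R -> T -> R)
  (a : R) (w : T) : R := expR (- (kappa * a)) * Z (expR a) w.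

Section lamperti.
Context {R : realType} {d : measure_display} {T : measurableType d}.
Variables (PZ : probability T R) (kappa : R) (Z : R -> T -> R).
Hypotheses (mZ : process_measurable Z) (cZ : cadlag Z)
  (ssZ : self_similar PZ kappa Z).
Local Notation Y := (lamperti kappa Z).

(** Joint measurability is what makes [Y], evaluated at a random time, a random variable. *)
Lemma measurable_lamperti : measurable_fun setT (fun p : R * T => Y p.1 p.2).
Proof.
apply: measurable_funM.
  apply: measurableT_comp; first exact: measurable_expR.
  apply: measurableT_comp; first exact: oppr_measurable.
  by apply: measurable_funM => //; exact: measurable_fst.
apply: (@measurable_right_continuous _ _ _ (fun a => Z (expR a))).
  by move=> t; apply: mZ; exact: expR_ge0.
move=> w t.
apply: (@increasing_cvg_at_right_comp _ expR (Z^~ w) t (BInfty _ false)) => //.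
- by move=> x y _ _; rewrite ltr_expR.
- by apply: cvg_at_right_filter; exact: continuous_expR.
- by apply: (cZ w).1; exact: expR_ge0.
Qed.

(** A shift by [b] multiplies the times of [Z] by [expR b]; the power that self-similarity then
    produces cancels against the change of the prefactor. *)
Lemma lamperti_stationary n (t : nat -> R) (b : R) (A : nat -> set R) :
  (forall i, measurable (A i)) ->
  PZ (cylinder n (fun i => Y (t i + b)) A) = PZ (cylinder n (fun i => Y (t i)) A).
Proof.
move=> mA.
pose A' i := [set x | A i (expR (- (kappa * (t i + b))) * x)].
have mA' i : measurable (A' i).
  by apply: preimage_fun_measurable => //; exact: measurable_funM.
have := @ssZ (expR b) (expR_gt0 b) n (fun i => expR (t i)) A'
  (fun i => expR_ge0 _) mA'.
rewrite -/(cylinder n (fun i w => Z (expR b * expR (t i)) w) A').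
rewrite -/(cylinder n (fun i w => (expR b) `^ kappa * Z (expR (t i)) w) A').
have -> : cylinder n (fun i w => Z (expR b * expR (t i)) w) A' =
    cylinder n (fun i => Y (t i + b)) A.
  apply: eq_cylinder => i w _.
  by rewrite /A'/= /lamperti (expRD (t i) b) (mulrC (expR (t i))).
move=> ->; congr (PZ _); apply: eq_cylinder => i w _.
rewrite /A'/= /lamperti expR_powR mulrA -expRD.
by rewrite (_ : - (kappa * (t i + b)) + kappa * b = - (kappa * t i))//; lra.
Qed.

Lemma lamperti_marginal a A : measurable A ->
  PZ [set w | A (Y a w)] = PZ [set w | A (Z 1 w)].
Proof.
move=> mA.
have := @lamperti_stationary 1 (fun=> 0) a (fun=> A) (fun=> mA).
rewrite !cylinderS !cylinder0 !setTI add0r => ->.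
congr (PZ _).
by apply/seteqP; split => w /=; rewrite /lamperti mulr0 oppr0 expR0 mul1r.
Qed.

End lamperti.

(** * The time-changed process: its past and its Markov property *)

Definition subordinated {R : realType} {T W : Type} (kappa : R)
    (Z : R -> T -> R) (a : R -> W -> R) (v : R) (p : T * W) : R :=
  lamperti kappa Z (a v p.2) p.1.

(** The interface of the time change, which hides its construction from two copies. Earlier values
    appear only relative to [a v], the form in which they are independent of the next increment. *)
Record subordinating {R : realType} {d d' : measure_display}
    {W : measurableType d} {T' : measurableType d'} (PW : probability W R)
    (Q : probability T' R) (zeta : R -> T' -> R) (a : R -> W -> R) : Prop := {
  subordinating_measurable : forall v, measurable_fun setT (a v) ;
  subordinating_le : forall u v w, u <= v -> a u w <= a v w ;
  subordinating_independent : forall n (u : nat -> R) v v' (A : nat -> set R) D,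
    v <= v' -> (forall i, (i < n)%N -> u i <= v) ->
    (forall i, measurable (A i)) -> measurable D ->
    (PW (cylinder n (fun i w => a (u i) w - a v w)%R A `&`
         [set w | D (a v' w - a v w)%R]) =
     PW (cylinder n (fun i w => a (u i) w - a v w)%R A) *
     Q [set w | D (zeta (v' - v)%R w)])%E }.

Lemma two_sided_subordinating {R : realType} {d : measure_display}
    {T : measurableType d} (Q : probability T R) (zeta : R -> T -> R)
    (psi : R -> R) : subordinator Q zeta psi ->
  subordinating (product_prob Q Q) Q zeta (two_sided zeta).
Proof.
move=> sub; split.
- by move=> v; exact: (measurable_two_sided sub).
- by move=> u v w; exact: (two_sided_le sub).
- by move=> *; exact: (two_sided_independent sub).
Qed.

(** Generators, closed under intersection, of the past of a process indexed by the whole real line,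
    whereas [nat_filtration] starts at time 0. *)
Definition past_cylinders {R : realType} {T : Type} (V : R -> T -> R) (v : R) :
    set (set T) :=
  [set B | exists n u A, [/\ (forall i, u i <= v),
     (forall i, measurable (A i)) & B = cylinder n (fun i => V (u i)) A]].

Section past_cylinders.
Context {R : realType} {T : Type}.
Variables (V : R -> T -> R) (v : R).

Lemma past_cylinders_setT : past_cylinders V v setT.
Proof. by exists 0%N, (fun=> v), (fun=> setT); rewrite cylinder0. Qed.

Lemma past_cylinders_setI : setI_closed (past_cylinders V v).
Proof.
move=> _ _ [n [u [A [uv mA ->]]]] [m [u' [A' [uv' mA' ->]]]].
exists (n + m)%N, (fun i => if (i < n)%N then u i else u' (i - n)%N),
  (fun i => if (i < n)%N then A i else A' (i - n)%N); split.
- by move=> i; case: ifP.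
- by move=> i; case: ifP.
apply/seteqP; split => [p [h h'] i /= inm|p h].
  case: ifPn => [/h //|]; rewrite -leqNgt => ni.
  by apply: h' => /=; rewrite ltn_subLR.
split => i /= ni.
  by have := h i; rewrite /= ni; apply; rewrite (leq_trans ni)// leq_addr.
have nni : (n + i < n)%N = false by rewrite ltnNge leq_addr.
have := h (n + i)%N; rewrite /= nni addKn; apply.
by rewrite ltn_add2l.
Qed.

Lemma past_preimage u A : u <= v -> measurable A ->
  <<s past_cylinders V v >> (V u @^-1` A).
Proof.
move=> uv mA; apply: sub_sigma_algebra; exists 1%N, (fun=> u), (fun=> A); split => //.
by rewrite cylinderS cylinder0 setTI.
Qed.

End past_cylinders.

Section subordinated_process.
Context {R : realType} {d d' dW : measure_display} {T : measurableType d}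
  {T' : measurableType d'} {W : measurableType dW}.
Variables (kappa : R) (PZ : probability T R) (Z : R -> T -> R)
  (Q : probability T' R) (zeta : R -> T' -> R) (PW : probability W R)
  (a : R -> W -> R).
Hypotheses (mZ : process_measurable Z) (cZ : cadlag Z)
  (ssZ : self_similar PZ kappa Z) (suba : subordinating PW Q zeta a).
Local Notation Y := (lamperti kappa Z).
Local Notation V := (subordinated kappa Z a).
Local Notation PX := (product_prob PZ PW).
Local Open Scope ereal_scope.

Let ma v : measurable_fun setT (a v). Proof. exact: (subordinating_measurable suba). Qed.

Lemma measurable_subordinated v : measurable_fun setT (V v).
Proof.
apply: (measurableT_comp (measurable_lamperti kappa mZ cZ)
  (g := fun p : T * W => (a v p.2, p.1))).
apply: measurable_fun_pair; last exact: measurable_fst.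
by apply: measurableT_comp; [exact: ma|exact: measurable_snd].
Qed.

Lemma measurable_past v : <<s past_cylinders V v >> `<=` measurable.
Proof.
apply: smallest_sub; first exact: sigma_algebra_measurable.
move=> _ [n [u [A [_ mA ->]]]]; apply: measurable_cylinder => // i _.
exact: measurable_subordinated.
Qed.

Let measurable_shifted v u :
  measurable_fun setT (fun p : T * W => Y (a u p.2 - a v p.2)%R p.1).
Proof.
apply: (measurableT_comp (measurable_lamperti kappa mZ cZ)
  (g := fun p : T * W => ((a u p.2 - a v p.2)%R, p.1))).
apply: measurable_fun_pair; last exact: measurable_fst.
by apply: measurable_funB; apply: measurableT_comp;
  [exact: ma|exact: measurable_snd|exact: ma|exact: measurable_snd].
Qed.

(** For a fixed path of [a], subtracting [a v] is a deterministic shift, which the stationarity of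
    [Y] permits. *)
Lemma subordinated_shift v n u A (E : set W) :
  (forall i, measurable (A i)) -> measurable E ->
  PX (cylinder n (fun i => V (u i)) A `&` [set p | E p.2]) =
  PX (cylinder n (fun i p => Y (a (u i) p.2 - a v p.2)%R p.1) A `&`
      [set p | E p.2]).
Proof.
move=> mA mE.
have mE' : measurable [set p : T * W | E p.2].
  by rewrite -[X in measurable X]setTI; exact: measurable_snd.
rewrite [LHS]product_prob_ysections; last first.
  apply: measurableI => //; apply: measurable_cylinder => // i _.
  exact: measurable_subordinated.
rewrite [RHS]product_prob_ysections; last first.
  by apply: measurableI => //; exact: measurable_cylinder.
apply: eq_integral => w _.
have [Ew|Ew] := pselect (E w); last first.
  by congr (PZ _); apply/seteqP; split => x [].
transitivity (PZ (cylinder n (fun i => Y (a (u i) w - a v w + a v w)%R) A)).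
  by congr (PZ _); apply/seteqP; split => [x [h _] i ni|x h];
    [rewrite /= subrK; exact: h|split => // i ni; have := h _ ni; rewrite /= subrK].
rewrite (@lamperti_stationary _ _ _ _ _ _ ssZ n (fun i => a (u i) w - a v w)%R)//.
by congr (PZ _); apply/seteqP; split => [x h|x []].
Qed.

Lemma past_independent v v' B D : (v <= v')%R ->
  <<s past_cylinders V v >> B -> measurable D ->
  PX (B `&` [set p | D (a v' p.2 - a v p.2)%R]) =
  PX B * Q [set w | D (zeta (v' - v)%R w)].
Proof.
move=> vv' FB mD.
have mxi : measurable_fun setT (fun w => a v' w - a v w)%R.
  by apply: measurable_funB; exact: ma.
pose E := [set w | D (a v' w - a v w)%R].
have mE : measurable E by exact: preimage_fun_measurable.
have mE' : measurable [set p : T * W | E p.2].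
  by rewrite -[X in measurable X]setTI; exact: measurable_snd.
apply: (@independent_from_pi_system _ _ _ PX (past_cylinders V v)) => //.
- by move=> C GC; apply: (@measurable_past v); exact: sub_sigma_algebra.
- exact: past_cylinders_setI.
- exact: past_cylinders_setT.
move=> {B FB} _ [n [u [A [uv mA ->]]]].
have := @subordinated_shift v n u A setT mA measurableT.
rewrite setIT setIT => shiftT.
rewrite [LHS](subordinated_shift v n u mA mE) [X in _ = X * _]shiftT.
set C := cylinder n _ A.
have mC : measurable C by exact: measurable_cylinder.
(* Now the path of [Z] is fixed instead: the section of [C] is a cylinder in the increments of [a]
   up to [v]. *)
rewrite [LHS]product_prob_xsections; last exact: measurableI.
have PXC : PX C = \int[PZ]_w PW [set x | C (w, x)].
  exact: product_prob_xsections.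
have mQC : measurable_fun setT (fun w => PW [set x | C (w, x)]).
  exact: measurable_xsections.
set q := Q _.
transitivity (\int[PZ]_w (PW [set x | C (w, x)] * q)); last first.
  have q0 : 0 <= q by exact: measure_ge0.
  have PW0 w : setT w -> 0 <= PW [set x | C (w, x)].
    by move=> _; exact: measure_ge0.
  by rewrite (ge0_integralZr PZ measurableT mQC PW0 q0) -PXC.
apply: eq_integral => w _.
pose A' i := [set x | A i (Y x w)].
have mA' i : measurable (A' i).
  apply: (preimage_fun_measurable _ (mA i)).
  exact: (measurable_fun_pair1 w (measurable_lamperti kappa mZ cZ)).
exact: (subordinating_independent suba vv' (fun i _ => uv i) mA' mD).
Qed.

End subordinated_process.

Section subordinated_markov.
Context {R : realType} {d d' dW : measure_display} {T : measurableType d}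
  {T' : measurableType d'} {W : measurableType dW}.
Variables (kappa : R) (PZ : probability T R) (Z : R -> T -> R)
  (P : R -> R -> R -> probability R R) (Q : probability T' R)
  (zeta : R -> T' -> R) (PW : probability W R) (a : R -> W -> R).
Hypotheses (mZ : process_measurable Z) (cZ : cadlag Z)
  (trP : transition_function P)
  (mkZ : markov_with PZ Z (fun s t x A => P s t x A))
  (ssZ : self_similar PZ kappa Z)
  (suba : subordinating PW Q zeta a)
  (mzeta : forall t, 0 <= t -> measurable_fun setT (zeta t))
  (zeta0 : forall t w, 0 <= t -> 0 <= zeta t w).
Local Notation Y := (lamperti kappa Z).
Local Notation V := (subordinated kappa Z a).
Local Notation PX := (product_prob PZ PW).
Local Open Scope ereal_scope.

Let ma v : measurable_fun setT (a v). Proof. exact: (subordinating_measurable suba). Qed.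
Let mV v : measurable_fun setT (V v).
Proof. exact: (measurable_subordinated _ mZ cZ suba). Qed.
Let mpast v B : <<s past_cylinders V v >> B -> measurable B.
Proof. exact: (@measurable_past _ _ _ _ _ _ _ kappa _ _ _ _ _ mZ cZ suba). Qed.
Let mxi v v' : measurable_fun setT (fun p : T * W => a v' p.2 - a v p.2)%R.
Proof.
by apply: measurable_funB; apply: measurableT_comp;
  [exact: ma|exact: measurable_snd|exact: ma|exact: measurable_snd].
Qed.

Lemma past_freeze v v' B (k : R * R -> \bar R) : (v <= v')%R ->
  <<s past_cylinders V v >> B ->
  measurable_fun setT k -> (forall x, 0 <= k x) ->
  \int[PX]_(p in B) k (V v p, a v' p.2 - a v p.2)%R =
  \int[PX]_(p in B) \int[Q]_w k (V v p, zeta (v' - v)%R w).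
Proof.
move=> vv' FB mk k0.
(* Freezing is applied with [U] the identity into the sample space equipped with the past of [V], so
   that the indicator of [B] becomes part of the integrand. *)
pose S := g_sigma_algebraType (past_cylinders V v).
have mVS : measurable_fun setT (V v : S -> R).
  by move=> _ A mA; rewrite setTI; exact: past_preimage.
have vv0 : (0 <= v' - v)%R by rewrite subr_ge0.
pose h (z : S * R) := k (V v z.1, z.2) * (\1_B z.1)%:E.
have mh : measurable_fun setT h.
  apply: emeasurable_funM.
    apply: measurableT_comp => //; apply: measurable_fun_pair.
      by apply: (measurableT_comp mVS); exact: measurable_fst.
    exact: measurable_snd.
  apply/measurable_EFinP.
  apply: (@measurableT_comp _ _ _ _ _ _ (\1_B : S -> R) _ fst);
    last exact: measurable_fst.
  exact: measurable_indic.
have h0 z : 0 <= h z by rewrite mule_ge0.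
rewrite integral_mkcond epatch_indic.
rewrite [RHS]integral_mkcond epatch_indic.
have mzv : measurable_fun setT (zeta (v' - v)%R).
  exact: mzeta.
have idS : measurable_fun setT (fun p : T * W => p : S).
  by move=> _ A FA; rewrite setTI; exact: mpast FA.
have := @integral_freeze _ _ _ _ _ _ S _ _ PX Q _ _ _ idS (mxi v v') mzv _ h mh h0.
move=> ->; last first.
  by move=> A D FA mD; exact: (past_independent mZ cZ ssZ suba vv' FA mD).
apply: eq_integral => p _; rewrite /h/= ge0_integralZr//.
apply: measurableT_comp => //.
by apply: measurable_fun_pair.
Qed.

(** As [a] is nondecreasing, a fixed path of it only reads [Z] up to time [expR (a v w)]. Sets with
    section in [F] form a sigma-algebra, so generators suffice. *)
Lemma past_section v B w : <<s past_cylinders V v >> B ->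
  nat_filtration Z (expR (a v w)) [set x | B (x, w)].
Proof.
move: B; pose F := nat_filtration Z (expR (a v w)).
have : <<s past_cylinders V v >> `<=` image_set_system setT (pair^~ w) F.
  apply: smallest_sub.
    by apply: sigma_algebra_image; exact: smallest_sigma_algebra.
  move=> _ [n [u [A [uv mA ->]]]]; rewrite /image_set_system/= setTI.
  pose TF := g_sigma_algebraType [set B | exists u (A : set R),
    [/\ (0 <= u <= expR (a v w))%R, measurable A & B = Z u @^-1` A]].
  apply: (@measurable_cylinder _ _ TF n (fun i x => V (u i) (x, w))) => // i _.
  rewrite /subordinated /lamperti/=; apply: (@measurable_funM _ TF) => //.
  move=> _ D mD; rewrite setTI; apply: sub_sigma_algebra.
  exists (expR (a (u i) w)), D; split => //.
  by rewrite expR_ge0 ler_expR (subordinating_le suba).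
move=> h B /h; rewrite /image_set_system/= setTI.
exact.
Qed.

(** The free scale [tau] serves two uses: [tau = t] with [v' = ln t] gives [X t], and [tau = 1]
    gives [V v'] itself. *)
Lemma subordinated_markov v v' tau B A : (v <= v')%R -> (0 < tau)%R ->
  <<s past_cylinders V v >> B -> measurable A ->
  PX (B `&` [set p | A (tau `^ kappa * V v' p)%R]) =
  \int[PX]_(p in B) \int[Q]_w
    P (expR (- zeta (v' - v)%R w) * tau)%R tau
      (tau `^ kappa * expR (- (kappa * zeta (v' - v)%R w)) * V v p)%R A.
Proof.
move=> vv' tau0 FB mA.
have mB := mpast FB.
have mtV : measurable [set p | A (tau `^ kappa * V v' p)%R].
  by apply: preimage_fun_measurable => //; exact: measurable_funM.
(* The absolute value makes the kernel measurable on all of [R * R]. *)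
pose k (z : R * R) := P (expR (- `|z.2|) * tau)%R tau
  (tau `^ kappa * expR (- (kappa * `|z.2|)) * z.1)%R A.
have mabs : measurable_fun setT (fun z : R * R => `|z.2|%R).
  by apply: measurableT_comp => //; exact: measurable_snd.
have mk : measurable_fun setT k.
  apply: (measurable_transition trP) => //; first exact: ltW.
  - apply: measurable_funM => //; apply: measurableT_comp => //.
    exact: measurableT_comp.
  - apply: measurable_funM; last exact: measurable_fst.
    apply: measurable_funM => //; apply: measurableT_comp => //.
    by apply: measurableT_comp => //; exact: measurable_funM.
  - move=> z; rewrite mulr_ge0 ?expR_ge0 ?(ltW tau0)//=.
    by rewrite ger_pMl// -expR0 ler_expR oppr_le0.
have k0 z : 0 <= k z by [].
have vv0 : (0 <= v' - v)%R by rewrite subr_ge0.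
transitivity (\int[PX]_(p in B) k (V v p, a v' p.2 - a v p.2)%R); last first.
  rewrite (past_freeze vv' FB mk k0); apply: eq_integral => p _.
  apply: eq_integral => w _; rewrite /k/= ger0_norm//.
  exact: zeta0.
rewrite [LHS]product_prob_ysections; last exact: measurableI.
have mkp : measurable_fun setT (fun p => k (V v p, a v' p.2 - a v p.2)%R).
  by apply: measurableT_comp => //; apply: measurable_fun_pair.
rewrite [RHS]integral_mkcond epatch_indic [RHS]ge0_integral_product_prob; last 2 first.
- by apply: emeasurable_funM => //; apply/measurable_EFinP.
- by move=> p; apply: mule_ge0 => //; rewrite lee_fin.
apply: eq_integral => w _.
have aw : (a v w <= a v' w)%R by exact: (subordinating_le suba).
(* This scale moves the end time [expR (a v' w)] of [Z] to [tau] for every path of [a]; the initial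
   time then depends on the path only through the increment. *)
pose c := (tau * expR (- a v' w))%R.
have c0 : (0 < c)%R by rewrite mulr_gt0// expR_gt0.
have ck : (c `^ kappa = tau `^ kappa * expR (- (kappa * a v' w)))%R.
  by rewrite powRM ?expR_ge0 ?(ltW tau0)// expR_powR mulrN.
have e : (expR (a v w) <= expR (a v' w))%R by rewrite ler_expR.
have := markov_rescaled mZ ssZ trP mkZ (expR_ge0 _) e c0 (@past_section v B w FB) mA.
have -> : [set x | B (x, w)] `&` [set x | A (c `^ kappa * Z (expR (a v' w)) x)%R] =
    [set x | (B `&` [set p | A (tau `^ kappa * V v' p)%R]) (x, w)].
  by apply/seteqP; split => x /=; rewrite ck /subordinated /lamperti/= mulrA.
move=> ->; rewrite integral_mkcond epatch_indic; apply: eq_integral => x _.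
congr (_ * _); rewrite /k/= ger0_norm ?subr_ge0//.
have -> : (c * expR (a v' w) = tau)%R.
  by rewrite /c -mulrA -expRD addNr expR0 mulr1.
have -> : (c * expR (a v w) = expR (- (a v' w - a v w)) * tau)%R.
  by rewrite /c -mulrA -expRD mulrC; congr (expR _ * _)%R; lra.
congr (P _ _ _ A); rewrite ck /subordinated /lamperti/= !mulrA; congr (_ * _)%R.
by rewrite -!mulrA -expRD; congr (_ * expR _)%R; lra.
Qed.

End subordinated_markov.

Section same_law.
Context {R : realType} {d1 d2 : measure_display} {T1 : measurableType d1}
  {T2 : measurableType d2}.
Variables (Q1 : probability T1 R) (Q2 : probability T2 R) (B1 : set T1)
  (B2 : set T2) (V1 : T1 -> R) (V2 : T2 -> R).
Hypotheses (mB1 : measurable B1) (mB2 : measurable B2)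
  (mV1 : measurable_fun setT V1) (mV2 : measurable_fun setT V2).
Local Open Scope ereal_scope.
Hypothesis same : forall D, measurable D ->
  Q1 (B1 `&` [set w | D (V1 w)]) = Q2 (B2 `&` [set w | D (V2 w)]).

Let ge0_integral_restr d (T : measurableType d) (Q : probability T R) B
    (mB : measurable B) (V : T -> R) (mV : measurable_fun setT V)
    (K : R -> \bar R) : measurable_fun setT K -> (forall x, 0 <= K x) ->
  \int[Q]_(w in B) K (V w) = \int[pushforward (mrestr Q mB) V]_x K x.
Proof.
move=> mK K0.
have mKV : measurable_fun setT (K \o V) by exact: measurableT_comp.
rewrite ge0_integral_pushforward// preimage_setT.
rewrite (@ge0_negligible_integral _ _ _ (mrestr Q mB) setT (~` B))//; last 3 first.
- exact: measurableC.
- by move=> x _; exact: K0.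
- by rewrite /= /mrestr setICl measure0.
rewrite setTD setCK; apply: eq_measure_integral => A mA AB.
by rewrite /= /mrestr setIidl.
Qed.

(** Both sides integrate [K] against the same finite measure on the line, the image of a probability
    restricted to an event. *)
Lemma ge0_integral_same_law (K : R -> \bar R) :
  measurable_fun setT K -> (forall x, 0 <= K x) ->
  \int[Q1]_(w in B1) K (V1 w) = \int[Q2]_(w in B2) K (V2 w).
Proof.
move=> mK K0; rewrite !ge0_integral_restr//.
pose m1 := measure_function_pushforward__canonical__measure_function_Measure
    (mrestr Q1 mB1) mV1.
pose m2 := measure_function_pushforward__canonical__measure_function_Measure
    (mrestr Q2 mB2) mV2.
apply: (@eq_measure_integral _ _ _ _ m2 m1) => A mA _.
by rewrite /m1 /m2/= /pushforward /mrestr/= setIC same// setIC.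
Qed.

Lemma integral_same_law (K : R -> \bar R) : measurable_fun setT K ->
  \int[Q1]_(w in B1) K (V1 w) = \int[Q2]_(w in B2) K (V2 w).
Proof.
move=> mK.
have posE (S : Type) (f : S -> R) : (fun x => K (f x))^\+ = (K^\+ \o f).
  exact: (funepos_comp K f).
have negE (S : Type) (f : S -> R) : (fun x => K (f x))^\- = (K^\- \o f).
  exact: (funeneg_comp K f).
rewrite integralE [RHS]integralE (posE _ V1) (posE _ V2) (negE _ V1) (negE _ V2).
congr (_ - _).
  by apply: ge0_integral_same_law => //; exact: measurable_funepos.
by apply: ge0_integral_same_law => //; exact: measurable_funeneg.
Qed.

End same_law.

(** * Stationarity of the time-changed process *)

Section subordinated_stationary.
Context {R : realType} {d d' dW : measure_display} {T : measurableType d}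
  {T' : measurableType d'} {W : measurableType dW}.
Variables (kappa : R) (PZ : probability T R) (Z : R -> T -> R)
  (P : R -> R -> R -> probability R R) (Q : probability T' R)
  (zeta : R -> T' -> R) (PW : probability W R) (a : R -> W -> R).
Hypotheses (mZ : process_measurable Z) (cZ : cadlag Z)
  (trP : transition_function P)
  (mkZ : markov_with PZ Z (fun s t x A => P s t x A))
  (ssZ : self_similar PZ kappa Z)
  (suba : subordinating PW Q zeta a)
  (mzeta : forall t, 0 <= t -> measurable_fun setT (zeta t))
  (zeta0 : forall t w, 0 <= t -> 0 <= zeta t w).
Local Notation Y := (lamperti kappa Z).
Local Notation V := (subordinated kappa Z a).
Local Notation PX := (product_prob PZ PW).
Local Open Scope ereal_scope.

Let mV v : measurable_fun setT (V v).
Proof. exact: (measurable_subordinated _ mZ cZ suba). Qed.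

Lemma subordinated_marginal v A : measurable A ->
  PX [set p | A (V v p)] = PZ [set w | A (Z 1%R w)].
Proof.
move=> mA.
have mAV : measurable [set p | A (V v p)] by exact: preimage_fun_measurable.
rewrite product_prob_ysections//.
rewrite (eq_integral (cst (PZ [set w | A (Z 1%R w)]))).
  by rewrite integral_cst// [X in _ * X](@probability_setT _ _ _ PW) mule1.
by move=> w _; exact: (@lamperti_marginal _ _ _ PZ kappa Z ssZ (a v w) A mA).
Qed.

(** The last coordinate has its own set [D], so the induction hypothesis fixes its law on the event
    described by the earlier coordinates; the next kernel depends on the times only through their
    difference. *)
Lemma chain_stationary (tau : nat -> R) (h : R) n (A : nat -> set R) D :
  (forall i, tau i <= tau i.+1)%R -> (forall i, measurable (A i)) ->
  measurable D ->
  PX (cylinder n (fun i => V (tau i + h)%R) A `&` [set p | D (V (tau n + h)%R p)]) =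
  PX (cylinder n (fun i => V (tau i)) A `&` [set p | D (V (tau n) p)]).
Proof.
move=> tauS mA; elim: n D => [|n IH] D mD.
  rewrite !cylinder0 !setTI.
  transitivity (PZ [set w | D (Z 1%R w)]).
    exact: subordinated_marginal.
  by apply/esym; exact: subordinated_marginal.
have tau_le m i : (i <= m)%N -> (tau i <= tau m)%R.
  elim: m => [|m IHm]; first by rewrite leqn0 => /eqP ->.
  rewrite leq_eqVlt ltnS => /orP[/eqP ->//|/IHm le_im].
  exact: le_trans (tauS m).
pose delta := (tau n.+1 - tau n)%R.
pose K x := \int[Q]_w P (expR (- zeta delta w) * 1)%R 1%R
      (1 `^ kappa * expR (- (kappa * zeta delta w)) * x)%R D.
have delta0 : (0 <= delta)%R by rewrite subr_ge0.
have K0 x : 0 <= K x by exact: integral_ge0.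
have mK : measurable_fun setT K.
  pose k (z : R * T') := P (expR (- zeta delta z.2) * 1)%R 1%R
      (1 `^ kappa * expR (- (kappa * zeta delta z.2)) * z.1)%R D.
  have mz : measurable_fun setT (fun z : R * T' => zeta delta z.2).
    by apply: measurableT_comp; [exact: mzeta|exact: measurable_snd].
  apply: (measurable_fun_fubini_tonelli_F k) => //.
  apply: (measurable_transition trP) => //.
  - apply: measurable_funM => //; apply: measurableT_comp => //.
    exact: measurableT_comp.
  - apply: measurable_funM; last exact: measurable_fst.
    apply: measurable_funM => //; apply: measurableT_comp => //.
    by apply: measurableT_comp => //; exact: measurable_funM.
  - move=> z; rewrite mulr1 expR_ge0/= -expR0 ler_expR oppr_le0.
    exact: zeta0.
(* The Markov property with [tau] equal to 1. [K] does not involve [b], so the cases [h] and 0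
   differ only in the law integrated against. *)
have step b : PX (cylinder n.+1 (fun i => V (tau i + b)%R) A `&`
      [set p | D (V (tau n.+1 + b)%R p)]) =
    \int[PX]_(p in cylinder n (fun i => V (tau i + b)%R) A `&`
      [set p | A n (V (tau n + b)%R p)]) K (V (tau n + b)%R p).
  rewrite -cylinderS.
  have le1 : (tau n + b <= tau n.+1 + b)%R by rewrite lerD2r.
  have FB : <<s past_cylinders V (tau n + b)%R >>
      (cylinder n.+1 (fun i => V (tau i + b)%R) A).
    apply: sub_sigma_algebra.
    (* [past_cylinders] bounds the times at all indices, hence the cap at [n]. *)
    exists n.+1, (fun i => tau (minn i n) + b)%R, A; split => //.
      by move=> i; rewrite lerD2r tau_le// geq_minr.
    by apply: eq_cylinder => i p; rewrite ltnS => /minn_idPl ->.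
  have := subordinated_markov mZ cZ trP mkZ ssZ suba mzeta zeta0 le1 ltr01 FB mD.
  rewrite (_ : tau n.+1 + b - (tau n + b) = delta)%R; last by rewrite /delta; lra.
  move=> <-; congr (PX (_ `&` _)).
  by apply/seteqP; split => p /=; rewrite powR1 mul1r.
rewrite step; have := step 0%R; under eq_fun do rewrite addr0.
rewrite !addr0 => ->.
have mc b : measurable (cylinder n (fun i => V (tau i + b)%R) A).
  exact: measurable_cylinder.
have mc0 : measurable (cylinder n (fun i => V (tau i)) A).
  exact: measurable_cylinder.
have mAn b : measurable [set p | A n (V (tau n + b)%R p)].
  exact: (preimage_fun_measurable (mV _) (mA n)).
have mAn0 : measurable [set p | A n (V (tau n) p)].
  exact: (preimage_fun_measurable (mV _) (mA n)).
apply: (@ge0_integral_same_law _ _ _ _ _ PX PX _ _ _ _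
  (measurableI _ _ (mc h) (mAn h)) (measurableI _ _ mc0 mAn0)
  (mV _) (mV _) _ K mK K0) => E mE.
have := IH (A n `&` E) (measurableI _ _ (mA n) mE).
by rewrite -!setIA.
Qed.

Lemma subordinated_stationary n (u : nat -> R) (h : R) (A : nat -> set R) :
  (forall i, measurable (A i)) ->
  PX (cylinder n (fun i => V (u i + h)%R) A) = PX (cylinder n (fun i => V (u i)) A).
Proof.
move=> mA; case: n => [|n]; first by rewrite !cylinder0.
have [tau [tauS utau tauu]] := exists_nondecreasing_enum u n.+1.
(* After sorting, each time collects the constraints of all indices that share it. *)
pose A' j := \bigcap_i (if (i < n.+1)%N && (u i == tau j) then A i else setT).
have mA' j : measurable (A' j).
  by apply: bigcapT_measurable => i; case: ifP.
have cE b : cylinder n.+1 (fun i => V (u i + b)%R) A =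
    cylinder n.+1 (fun i => V (tau i + b)%R) A'.
  apply/seteqP; split => p hp j /= jn.
    by move=> i _; case: ifP => // /andP[ni /eqP <-]; exact: hp.
  have [i ni iE] := utau _ jn.
  by have := hp i ni j Logic.I; rewrite jn iE eqxx.
have := cE 0%R; under eq_fun do rewrite addr0; under [in RHS]eq_fun do rewrite addr0.
move=> ->; rewrite cE !cylinderS.
exact: (chain_stationary h n tauS mA' (mA' n)).
Qed.

End subordinated_stationary.

(** * The martingale property of the time-changed process *)

Section subordinated_martingale.
Context {R : realType} {d d' dW : measure_display} {T : measurableType d}
  {T' : measurableType d'} {W : measurableType dW}.
Variables (kappa : R) (PZ : probability T R) (Z : R -> T -> R)
  (Q : probability T' R)
  (zeta : R -> T' -> R) (PW : probability W R) (a : R -> W -> R).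
Hypotheses (kappa0 : 0 < kappa) (mZ : process_measurable Z) (cZ : cadlag Z)
  (ssZ : self_similar PZ kappa Z)
  (suba : subordinating PW Q zeta a)
  (mzeta : forall t, 0 <= t -> measurable_fun setT (zeta t))
  (zeta0 : forall t w, 0 <= t -> 0 <= zeta t w)
  (martZ : martingale PZ Z).
Local Notation Y := (lamperti kappa Z).
Local Notation V := (subordinated kappa Z a).
Local Notation PX := (product_prob PZ PW).
Local Open Scope ereal_scope.

Let mV v : measurable_fun setT (V v).
Proof. exact: (measurable_subordinated _ mZ cZ suba). Qed.
Let mpast v B : <<s past_cylinders V v >> B -> measurable B.
Proof. exact: (@measurable_past _ _ _ _ _ _ _ kappa _ _ _ _ _ mZ cZ suba). Qed.
Let mxi v v' : measurable_fun setT (fun p : T * W => a v' p.2 - a v p.2)%R.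
Proof.
by apply: measurable_funB; apply: measurableT_comp; (exact: measurable_snd ||
  exact: (subordinating_measurable suba)).
Qed.

Lemma integrable_subordinated v : PX.-integrable setT (EFin \o V v).
Proof.
have mZ1 : measurable_fun setT (Z 1%R) by exact: mZ.
have /integrableP[_ Z1oo] := martZ.1 1%R ler01.
apply/integrableP; split; first exact/measurable_EFinP.
rewrite (_ : \int[PX]_x _ = \int[PZ]_x `|(Z 1%R x)%:E|)//.
apply: (@ge0_integral_same_law _ _ _ _ _ PX PZ setT setT (V v) (Z 1%R)
  measurableT measurableT (mV v) mZ1 _ (fun x : R => `|x%:E|)) => //.
- by move=> D mD; rewrite !setTI; exact: (subordinated_marginal mZ cZ ssZ suba).
- by apply: measurableT_comp => //; exact: measurable_EFinP.
Qed.

Lemma past_freeze_exp v v' B (g : R -> R) : (v <= v')%R ->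
  <<s past_cylinders V v >> B -> measurable_fun setT g ->
  (forall x, 0 <= g x)%R ->
  \int[PX]_(p in B) (g (V v p) * expR (- (kappa * (a v' p.2 - a v p.2))))%:E =
  \int[PX]_(p in B) (g (V v p))%:E *
  \int[Q]_w (expR (- (kappa * zeta (v' - v)%R w)))%:E.
Proof.
move=> vv' FB mg g0.
pose k (z : R * R) := (g z.1 * expR (- (kappa * z.2)))%:E.
have mk : measurable_fun setT k.
  apply/measurable_EFinP; apply: measurable_funM.
    by apply: measurableT_comp => //; exact: measurable_fst.
  apply: measurableT_comp => //; apply: measurableT_comp => //.
  by apply: measurable_funM => //; exact: measurable_snd.
have k0 z : 0 <= k z by rewrite lee_fin mulr_ge0// expR_ge0.
rewrite (past_freeze mZ cZ ssZ suba mzeta vv' FB mk k0).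
have vv0 : (0 <= v' - v)%R by rewrite subr_ge0.
have mz : measurable_fun setT (zeta (v' - v)%R) by exact: mzeta.
rewrite -ge0_integralZr; last 4 first.
- exact: mpast FB.
- by apply/measurable_EFinP; apply: measurable_funTS; exact: measurableT_comp.
- by move=> p _; rewrite lee_fin.
- by apply: integral_ge0 => w _; rewrite lee_fin expR_ge0.
apply: eq_integral => p _; rewrite /k/=.
under eq_integral do rewrite EFinM.
rewrite ge0_integralZl.
- by [].
- exact: measurableT.
- apply/measurable_EFinP; apply: measurableT_comp => //.
  by apply: measurableT_comp => //; exact: measurable_funM.
- by move=> w _; rewrite lee_fin expR_ge0.
- by rewrite lee_fin.
Qed.

(** For a fixed path of [a], the martingale [Z] replaces [V v'] by [V v] times the exponential of
    [- kappa] times the increment of [a]; this factor is independent of the past and has mean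
    [rho]. *)
Lemma subordinated_martingale v v' B (rho : R) : (v <= v')%R ->
  <<s past_cylinders V v >> B ->
  \int[Q]_w (expR (- (kappa * zeta (v' - v)%R w)))%:E = rho%:E ->
  \int[PX]_(p in B) (V v' p)%:E = rho%:E * \int[PX]_(p in B) (V v p)%:E.
Proof.
move=> vv' FB rhoE; have mB := mpast FB.
set xi := fun p : T * W => (a v' p.2 - a v p.2)%R.
have xi0 p : (0 <= xi p)%R by rewrite subr_ge0; exact: (subordinating_le suba).
have mexp : measurable_fun setT (fun p => expR (- (kappa * xi p)))%R.
  apply: measurableT_comp => //; apply: measurableT_comp => //.
  by apply: measurable_funM => //; exact: mxi.
have mVe : measurable_fun setT (fun p => V v p * expR (- (kappa * xi p)))%R.
  exact: measurable_funM.
have intVe : PX.-integrable setT (fun p => (V v p * expR (- (kappa * xi p)))%:E).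
  apply: (le_integrable measurableT _ _ (integrable_subordinated v)).
    exact/measurable_EFinP.
  move=> p _ /=; rewrite lee_fin normrM (ger0_norm (expR_ge0 _)).
  apply: ler_piMr => //; rewrite -[leRHS]expR0 ler_expR oppr_le0 mulr_ge0//.
  exact: ltW.
have intB f : PX.-integrable setT f ->
    PX.-integrable setT (fun p => f p * (\1_B p)%:E).
  move=> intf; rewrite -epatch_indic; apply/(integrable_mkcond f mB).
  exact: (integrableS measurableT mB _ intf).
transitivity (\int[PX]_(p in B) (V v p * expR (- (kappa * xi p)))%:E).
  rewrite integral_mkcond epatch_indic integral_product_prob; last first.
    exact: (intB _ (integrable_subordinated v')).
  rewrite [RHS]integral_mkcond epatch_indic integral_product_prob; last first.
    exact: intB.
  apply: eq_integral => w _.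
  pose Bw := [set x | B (x, w)].
  have FBw : nat_filtration Z (expR (a v w)) Bw.
    exact: (past_section suba FB).
  have mBw : measurable Bw by exact: nat_filtration_measurable FBw.
  have e : (expR (a v w) <= expR (a v' w))%R.
    by rewrite ler_expR; exact: (subordinating_le suba).
  have mw := martZ.2 _ _ (expR_ge0 (a v w)) e Bw FBw.
  have intZ u : PZ.-integrable Bw (fun x => (Z (expR (a u w)) x)%:E).
    by apply: (integrableS measurableT mBw) => //; exact: (martZ.1 _ (expR_ge0 _)).
  transitivity (\int[PZ]_(x in Bw)
      ((expR (- (kappa * a v' w)))%:E * (Z (expR (a v' w)) x)%:E)).
    by rewrite [RHS]integral_mkcond epatch_indic.
  rewrite integralZl// mw -integralZl// [LHS]integral_mkcond epatch_indic.
  apply: eq_integral => x _; congr (_ * _).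
  rewrite -EFinM; congr (_%:E).
  rewrite /subordinated /lamperti/= mulrAC -expRD; congr (expR _ * _)%R.
  by rewrite /xi/=; lra.
(* Freezing is for nonnegative integrands, so the two parts are treated separately; the positive
   exponential factors out of each. *)
rewrite integralE [in RHS]integralE.
have posE : (fun p => (V v p * expR (- (kappa * xi p)))%:E)^\+ =
    (fun p => (Num.max (V v p) 0 * expR (- (kappa * xi p)))%:E).
  apply/funext => p; rewrite funeposE -EFin_max; congr (_%:E).
  by rewrite maxr_pMl ?expR_ge0// mul0r.
have negE : (fun p => (V v p * expR (- (kappa * xi p)))%:E)^\- =
    (fun p => (Num.max (- V v p) 0 * expR (- (kappa * xi p)))%:E).
  apply/funext => p; rewrite funenegE -EFinN -EFin_max; congr (_%:E).
  by rewrite maxr_pMl ?expR_ge0// mul0r mulNr.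
have mmax : measurable_fun setT (fun x : R => Num.max x 0%R).
  exact: measurable_maxr.
have mmaxN : measurable_fun setT (fun x : R => Num.max (- x)%R 0%R).
  by apply: measurable_maxr => //; exact: oppr_measurable.
have max0 (x : R) : (0 <= Num.max x 0)%R by rewrite le_max lexx orbT.
rewrite posE negE.
rewrite (past_freeze_exp vv' FB mmax)// (past_freeze_exp vv' FB mmaxN)//.
have -> : (fun p => (V v p)%:E)^\+ = (fun p => (Num.max (V v p) 0)%:E).
  by apply/funext => p; rewrite funeposE -EFin_max.
have negV : (fun p => (V v p)%:E)^\- = (fun p => (Num.max (- V v p) 0)%:E).
  by apply/funext => p; rewrite funenegE -EFinN -EFin_max.
(* Distributing [rho] over an extended difference needs it to be well defined: integrability of
   [V v] makes the subtracted integral finite. *)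
rewrite rhoE negV muleBr//; first by rewrite !(muleC rho%:E).
apply: fin_num_adde_defl; rewrite fin_numN -negV; apply: integrable_neg_fin_num => //.
exact: (integrableS measurableT mB _ (integrable_subordinated v)).
Qed.

End subordinated_martingale.

(** * Return to the process [X] *)

(** At time 0 the power factor vanishes for positive [kappa], which overrides the default value of
    [ln 0] and starts the process at 0. *)
Definition inverse_lamperti {R : realType} {T : Type} (kappa : R)
    (V : R -> T -> R) (t : R) (p : T) : R :=
  t `^ kappa * V (ln t) p.

Section inverse_lamperti.
Context {R : realType} {d : measure_display} {T : measurableType d}.
Variables (kappa : R) (V : R -> T -> R).
Hypothesis kappa0 : 0 < kappa.
Local Notation X := (inverse_lamperti kappa V).

Lemma inverse_lamperti0 p : X 0 p = 0.
Proof. by rewrite /inverse_lamperti powR0 ?mul0r// gt_eqF. Qed.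

Let const_preimage A : X 0 @^-1` A = set0 \/ X 0 @^-1` A = setT.
Proof.
have [A0|A0] := pselect (A 0).
  by right; apply/seteqP; split => // p _ /=; rewrite inverse_lamperti0.
by left; apply/seteqP; split => // p /=; rewrite inverse_lamperti0.
Qed.

Lemma inverse_lamperti_filtration s : 0 < s ->
  nat_filtration X s `<=` <<s past_cylinders V (ln s) >>.
Proof.
move=> s0; apply: smallest_sub; first exact: smallest_sigma_algebra.
move=> _ [u [A [/andP[u0 us] mA ->]]].
have [->|u_neq0] := eqVneq u 0.
  have sa := smallest_sigma_algebra setT (past_cylinders V (ln s)).
  case: (const_preimage A) => ->; first by case: sa.
  by case: sa => z1 z2 _; have := z2 _ z1; rewrite setD0.
have {}u0 : 0 < u by rewrite lt_neqAle eq_sym u_neq0.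
rewrite (_ : _ @^-1` _ = V (ln u) @^-1` [set x | A (u `^ kappa * x)]); last first.
  by apply/seteqP; split.
apply: past_preimage; first by rewrite ler_ln ?posrE.
by apply: preimage_fun_measurable => //; exact: measurable_funM.
Qed.

Lemma inverse_lamperti_filtration0 B : nat_filtration X 0 B ->
  B = set0 \/ B = setT.
Proof.
have : nat_filtration X 0 `<=` [set B | B = set0 \/ B = setT].
  apply: smallest_sub.
    split => /=.
    - by left.
    - by move=> D [->|->]; rewrite ?setD0 ?setDv; [right|left].
    - move=> F F01; have [[i Fi]|nF] := pselect (exists i, F i = setT).
        by right; apply/seteqP; split => // x _; exists i => //; rewrite Fi.
      left; apply: bigcup0 => i _; case: (F01 i) => // Fi.
      by exfalso; apply: nF; exists i.
  move=> _ [u [A [/andP[u0 us] mA ->]]].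
  have -> : u = 0 by apply/eqP; rewrite eq_le us.
  exact: const_preimage.
by apply.
Qed.

End inverse_lamperti.

Section subordinated_self_similar.
Context {R : realType} {d d' dW : measure_display} {T : measurableType d}
  {T' : measurableType d'} {W : measurableType dW}.
Variables (kappa : R) (PZ : probability T R) (Z : R -> T -> R)
  (P : R -> R -> R -> probability R R) (Q : probability T' R)
  (zeta : R -> T' -> R) (psi : R -> R) (PW : probability W R)
  (a : R -> W -> R).
Hypotheses (kappa0 : 0 < kappa) (mZ : process_measurable Z) (cZ : cadlag Z)
  (trP : transition_function P)
  (mkZ : markov_with PZ Z (fun s t x A => P s t x A))
  (ssZ : self_similar PZ kappa Z)
  (sub : subordinator Q zeta psi)
  (suba : subordinating PW Q zeta a).
Local Notation V := (subordinated kappa Z a).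
Local Notation PX := (product_prob PZ PW).
Local Notation X := (inverse_lamperti kappa V).
Local Open Scope ereal_scope.

Let mzeta t : (0 <= t)%R -> measurable_fun setT (zeta t).
Proof. exact: (subordinator_measurable sub). Qed.
Let zeta0 t w : (0 <= t)%R -> (0 <= zeta t w)%R.
Proof. exact: (subordinator_ge0 sub). Qed.
Let mV v : measurable_fun setT (V v).
Proof. exact: (measurable_subordinated _ mZ cZ suba). Qed.
Let mX t : measurable_fun setT (X t).
Proof. by apply: measurable_funM => //; exact: mV. Qed.

Lemma ssub_process_measurable : process_measurable X.
Proof. by move=> t _; exact: mX. Qed.

Lemma ssub_marginal t A : (0 <= t)%R -> measurable A ->
  PX [set p | A (X t p)] = PZ [set w | A (Z t w)].
Proof.
move=> t0 mA.
have [->|t_neq0] := eqVneq t 0%R.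
  have mZ0 : measurable [set w | A (Z 0%R w)].
    exact: (preimage_fun_measurable (mZ (lexx _)) mA).
  have mN : measurable [set w | Z 0%R w != 0%R].
    exact: (measurable_neq0 (mZ (lexx _))).
  have N0 := self_similar_initial mZ ssZ kappa0.
  (* Both laws are the point mass at 0, so the probability is 1 or 0 according to whether [A]
     contains 0. *)
  have [A0|A0] := pselect (A 0%R).
    rewrite (_ : [set p | _] = setT); last first.
      by apply/seteqP; split => // p _ /=; rewrite inverse_lamperti0.
    rewrite probability_setT; apply/esym/eqP; rewrite eq_le probability_le1//=.
    rewrite -(probability_setT PZ).
    rewrite -[leRHS]adde0 -N0.
    apply: (le_trans _ (measureU2 _ mZ0 mN)).
    apply: le_measure; rewrite ?inE//; first exact: measurableU.
    move=> w _ /=; have [->|] := eqVneq (Z 0%R w) 0%R; first by left.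
    by right.
  rewrite (_ : [set p | _] = set0) ?measure0; last first.
    by apply/seteqP; split => // p /=; rewrite inverse_lamperti0.
  apply/esym; apply: (subset_measure0 mZ0 mN _ N0) => w /= Aw.
  by apply/eqP => Zw; apply: A0; rewrite -Zw.
have {}t0 : (0 < t)%R by rewrite lt_neqAle eq_sym t_neq0.
pose A' := [set x | A (t `^ kappa * x)%R].
have mA' : measurable A'.
  by apply: preimage_fun_measurable => //; exact: measurable_funM.
have := subordinated_marginal mZ cZ ssZ suba (ln t) mA'.
move=> h; apply: (eq_trans h) => {h}.
by have := self_similar1 ssZ t0 ler01 mA; rewrite mulr1 => ->.
Qed.

Lemma ssub_markov : markov_with PX X (Ptilde Q (fun s t x A => P s t x A) kappa zeta).
Proof.
move=> s t s0 st B A FB mA.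
have t0 : (0 <= t)%R by exact: le_trans st.
(* From time 0 the past is trivial, so only the law of [X t] matters: it is that of [Z t], and the
   Markov property of [Z] from [Z 0], almost surely 0, gives the kernel. *)
rewrite /Ptilde; have [s0'|s_neq0] := eqVneq s 0%R.
  move: FB; rewrite s0' => /(inverse_lamperti_filtration0 kappa0)[->|->].
    by rewrite set0I measure0 integral_set0.
  rewrite setTI.
  under eq_integral do rewrite (inverse_lamperti0 _ kappa0).
  rewrite integral_cst// [X in _ * X](@probability_setT _ _ _ PX) mule1.
  rewrite ssub_marginal//.
  have N0 := self_similar_initial mZ ssZ kappa0.
  have := mkZ (lexx 0%R) t0 (@nat_filtration_setT _ _ _ Z 0%R) mA.
  rewrite setTI => h; apply: (eq_trans h) => {h}.
  transitivity (\int[PZ]_w cst (P 0%R t 0%R A) w); last first.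
    by rewrite integral_cst// [X in _ * X](@probability_setT _ _ _ PZ) mule1.
  apply: ae_eq_integral => //.
    apply: (measurable_transition trP t0 mA) => //; first exact: mZ.
    by move=> _; rewrite lexx t0.
  exists [set w | Z 0%R w != 0%R]; split => //.
    exact: (measurable_neq0 (mZ (lexx _))).
  by move=> w /= ne; apply/eqP => Zw; apply: ne => _; rewrite Zw.
have {}s0 : (0 < s)%R by rewrite lt_neqAle eq_sym s_neq0.
have {}t0 : (0 < t)%R by exact: lt_le_trans st.
have lst : (ln s <= ln t)%R by rewrite ler_ln ?posrE.
have := subordinated_markov mZ cZ trP mkZ ssZ suba mzeta zeta0 lst t0
  (inverse_lamperti_filtration kappa0 s0 FB) mA.
move=> h; apply: (eq_trans h) => {h}; apply: eq_integral => p _.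
apply: eq_integral => w _; rewrite /Rsub ln_div ?posrE//.
congr (P _ _ _ A); rewrite expR_powR mulrN /inverse_lamperti.
have -> : (t `^ kappa = (t / s) `^ kappa * s `^ kappa)%R.
  by rewrite -powRM ?divr_ge0 ?ltW// divfK// gt_eqF.
by rewrite -!mulrA; congr (_ * _)%R; rewrite mulrCA.
Qed.

Lemma ssub_self_similar : self_similar PX kappa X.
Proof.
move=> c c0 n t A t0 mA.
(* At a zero time the logarithm is an arbitrary placeholder: the factor in [A'] is then 0 and both
   processes take the value 0. *)
pose u i := if t i == 0%R then 0%R else ln (t i).
pose A' i := [set x : R | A i ((c * t i) `^ kappa * x)%R].
have mA' i : measurable (A' i).
  by apply: preimage_fun_measurable => //; exact: measurable_funM.
have := subordinated_stationary mZ cZ trP mkZ ssZ suba mzeta zeta0 n u (ln c) mA'.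
have -> : cylinder n (fun i => V (u i + ln c)%R) A' =
    cylinder n (fun i => X (c * t i)%R) A.
  apply: eq_cylinder => i p _; rewrite /A' /u/= /inverse_lamperti.
  have [->|ti0] := eqVneq (t i) 0%R; first by rewrite mulr0 powR0 ?mul0r// gt_eqF.
  have {}ti0 : (0 < t i)%R by rewrite lt_neqAle eq_sym ti0 t0.
  by rewrite /= lnM ?posrE// [(ln c + _)%R]addrC.
move=> h; apply: (eq_trans h) => {h}; congr (PX _).
apply: eq_cylinder => i p _; rewrite /A' /u/= /inverse_lamperti.
have -> : ((c * t i) `^ kappa = c `^ kappa * t i `^ kappa)%R.
  by apply: powRM => //; exact: ltW.
have [->|ti0] := eqVneq (t i) 0%R; last by rewrite mulrA.
by rewrite powR0 ?mulr0 ?mul0r ?mulr0// gt_eqF.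
Qed.

Lemma ssub_martingale : martingale PZ Z -> psi kappa = kappa -> martingale PX X.
Proof.
move=> martZ psik.
have law K : measurable_fun setT K -> forall t, (0 <= t)%R ->
    \int[PX]_p K (X t p) = \int[PZ]_w K (Z t w).
  move=> mK t t0.
  apply: (@integral_same_law _ _ _ _ _ PX PZ setT setT (X t) (Z t)
    measurableT measurableT (mX t) (mZ t0) _ K mK) => D mD.
  by rewrite !setTI; exact: ssub_marginal.
split.
  move=> t t0; apply/integrableP; split.
    by apply/measurable_EFinP; exact: mX.
  have /integrableP[_] := martZ.1 _ t0.
  rewrite -(law (fun x => `|x%:E|)) //.
  by apply: measurableT_comp => //; exact: measurable_EFinP.
move=> s t s0 st B FB.
have t0 : (0 <= t)%R by exact: le_trans st.
have [s0'|s_neq0] := eqVneq s 0%R.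
  move: FB; rewrite s0' => /(inverse_lamperti_filtration0 kappa0)[->|->].
    by rewrite !integral_set0.
  rewrite !law//.
  by apply: martZ.2 => //; exact: nat_filtration_setT.
have {}s0 : (0 < s)%R by rewrite lt_neqAle eq_sym s_neq0.
have {}t0 : (0 < t)%R by exact: lt_le_trans st.
have lst : (ln s <= ln t)%R by rewrite ler_ln ?posrE.
have lst0 : (0 <= ln t - ln s)%R by rewrite subr_ge0.
have FB' := inverse_lamperti_filtration kappa0 s0 FB.
have mB : measurable B.
  exact: (measurable_past mZ cZ suba FB').
(* Here [psi kappa = kappa] makes the mean equal to [s / t] to the power [kappa], exactly what turns
   the prefactor of [X t] into that of [X s]. *)
have rhoE : \int[Q]_w (expR (- (kappa * zeta (ln t - ln s)%R w)))%:E =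
    (expR (- ((ln t - ln s) * kappa)))%:E.
  by case: sub => _ _ _ _ /(_ _ kappa lst0 (ltW kappa0)) ->; rewrite psik.
have intV v : PX.-integrable B (EFin \o V v).
  apply: (integrableS measurableT mB) => //.
  exact: (integrable_subordinated mZ cZ ssZ suba martZ).
have scale r : \int[PX]_(p in B) (X r p)%:E =
    (r `^ kappa)%:E * \int[PX]_(p in B) (V (ln r) p)%:E.
  by rewrite -(integralZl mB (intV (ln r))).
rewrite !scale.
rewrite (subordinated_martingale kappa0 mZ cZ ssZ suba mzeta martZ lst FB' rhoE).
rewrite muleA -EFinM; congr (_%:E * _).
rewrite /powR !gt_eqF// -expRD; congr expR; lra.
Qed.

End subordinated_self_similar.

Theorem theorem2p4 (R : realType) (kappa : R)
  (d : measure_display) (T : measurableType d) (PZ : probability T R)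
  (Z : R -> T -> R) (P : R -> R -> R -> probability R R)
  (d' : measure_display) (T' : measurableType d') (Pzeta : probability T' R)
  (zeta : R -> T' -> R) (psi : R -> R) :
  0 < kappa ->
  (* Z is a real-valued cadlag kappa-self-similar Markov process with
     transition function P *)
  process_measurable Z -> cadlag Z -> transition_function P ->
  markov_with PZ Z (fun s t x A => P s t x A) ->
  self_similar PZ kappa Z ->
  (* zeta is a subordinator with Laplace exponent psi *)
  subordinator Pzeta zeta psi ->
  exists (dX : measure_display) (TX : measurableType dX) (PX : probability TX R)
         (X : R -> TX -> R),
    [/\ process_measurable X /\ PX [set w | X 0 w = 0] = 1%E,
        markov_with PX X (Ptilde Pzeta (fun s t x A => P s t x A) kappa zeta),
        self_similar PX kappa X,
        (forall t (A : set R), 0 <= t -> measurable A ->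
           (PX (X t @^-1` A) = PZ (Z t @^-1` A))%E) &
        (martingale PZ Z -> psi kappa = kappa -> martingale PX X)].
Proof.
move=> kappa0 mZ cZ trP mkZ ssZ sub.
have suba := two_sided_subordinating sub.
exists _, _, (product_prob PZ (product_prob Pzeta Pzeta)),
  (inverse_lamperti kappa (subordinated kappa Z (two_sided zeta))); split.
- split; first exact: (ssub_process_measurable _ mZ cZ suba).
  rewrite (_ : [set w | _] = setT) ?probability_setT//.
  by apply/seteqP; split => // p _ /=; exact: inverse_lamperti0.
- exact: (ssub_markov kappa0 mZ cZ trP mkZ ssZ sub suba).
- exact: (ssub_self_similar kappa0 mZ cZ trP mkZ ssZ sub suba).
- by move=> t A; exact: (ssub_marginal kappa0 mZ cZ ssZ suba).
- exact: (ssub_martingale kappa0 mZ cZ ssZ sub suba).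
Qed.
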